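(* If $D$ is a strongly minimal set definable over the set $A$, then the operator $X\mapsto\mathrm{acl}(XA)$ restricted to $D$ (i.e. to the realizations of $D$ in the monster model) is the closure operator of a pregeometry with finite character.
   Context: Setting: continuous first-order logic for metric structures. $S_n(A)$ is the space of complete $n$-types over a parameter set $A$, a compact Hausdorff space under the logic topology, also equipped with the metric $d(p,q)=\inf\{d(\bar a,\bar b):\bar a\models p,\ \bar b\models q\}$ computed in a monster model. A formula over $A$ is a continuous function $S_n(A)\to\mathbb R$. A closed set $D\subseteq S_n(A)$ is ($A$-)definable if for every $\varepsilon>0$ there is an open $U$ with $D\subseteq U\subseteq D^{<\varepsilon}=\{q:d(q,D)<\varepsilon\}$. An $A$-zeroset is a set of types of the form $\{\varphi=0\}$ for a formula $\varphi$ over $A$. A zeroset or type over $A$ is algebraic if its set of realizations in every model $\mathfrak M\supseteq A$ is metrically compact. $\mathrm{acl}(B)$ is the set of elements $b$ such that $\mathrm{tp}(b/B)$ is algebraic. A non-algebraic definable set $D$ is minimal over the set $A$ if for each pair $F,G\subseteq D$ of disjoint $A$-zerosets, at most one of $F$ and $G$ is non-algebraic. A definable set is strongly minimal if it is minimal over every set of parameters (over which it is definable). *)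

(* Defs.v *)
(* Continuous first-order logic over MathComp-Analysis. *)
From HB Require Import structures.
From mathcomp Require Import all_boot all_order all_algebra.
From mathcomp Require Import all_classical all_reals all_analysis.

Set Implicit Arguments.
Unset Strict Implicit.
Unset Printing Implicit Defensive.

Import Order.TTheory GRing.Theory Num.Theory.
Import numFieldTopology.Exports numFieldNormedType.Exports.

Local Open Scope classical_set_scope.
Local Open Scope card_scope.
Local Open Scope ring_scope.

(** * Signatures and metric structures *)

(* One-sorted metric signatures, of arbitrary cardinality.  A function symbol
   carries a modulus of uniform continuity; a predicate symbol also carries a
   bounded interval of values. *)
Record signature (R : realType) := Signature {
  diameter : R;
  fsym : Type;
  farity : fsym -> nat;
  fmodulus : fsym -> R -> R;
  fmodulus_gt0 : forall f e, 0 < e -> 0 < fmodulus f e;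
  psym : Type;
  parity : psym -> nat;
  pmodulus : psym -> R -> R;
  pmodulus_gt0 : forall P e, 0 < e -> 0 < pmodulus P e;
  pmin : psym -> R;
  pmax : psym -> R
}.

Record mstructure (R : realType) (L : signature R) := MStructure {
  carrier :> metricType R;
  carrier_inhabited : inhabited carrier;
  carrier_complete : forall F : set_system carrier,
    ProperFilter F -> cauchy F -> exists x : carrier, F --> x;
  carrier_bounded : forall x y : carrier, mdist x y <= diameter L;
  finterp : forall f : fsym L, ('I_(farity f) -> carrier) -> carrier;
  finterp_uc : forall (f : fsym L) (e : R), 0 < e ->
    forall x y : 'I_(farity f) -> carrier,
      (forall i, mdist (x i) (y i) < fmodulus f e) ->
      mdist (finterp x) (finterp y) <= e;
  pinterp : forall P : psym L, ('I_(parity P) -> carrier) -> R;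
  pinterp_bounded : forall (P : psym L) (x : 'I_(parity P) -> carrier),
    pmin P <= pinterp x <= pmax P;
  pinterp_uc : forall (P : psym L) (e : R), 0 < e ->
    forall x y : 'I_(parity P) -> carrier,
      (forall i, mdist (x i) (y i) < pmodulus P e) ->
      `|pinterp x - pinterp y| <= e
}.

(** * Syntax and semantics *)

(* [formula L C n]: formulas in the de Bruijn variables 'I_n with constants for
   the elements of C; a quantifier binds variable 0.  Every continuous function
   R^k -> R is a connective. *)
Inductive term (R : realType) (L : signature R) (C : Type) (n : nat) : Type :=
| Var of 'I_n
| Par of C
| App (f : fsym L) of ('I_(farity f) -> term L C n).

Inductive formula (R : realType) (L : signature R) (C : Type) : nat -> Type :=
| Fdist n of term L C n & term L C n : formula L C n
| Fpred n (P : psym L) of ('I_(parity P) -> term L C n) : formula L C n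
| Fconn n k (u : 'rV[R]_k -> R) of continuous u & ('I_k -> formula L C n) :
    formula L C n
| Fsup n of formula L C n.+1 : formula L C n
| Finf n of formula L C n.+1 : formula L C n.

HB.instance Definition _ (R : realType) (L : signature R) (C : Type) (n : nat) :=
  gen_eqMixin (formula L C n).
HB.instance Definition _ (R : realType) (L : signature R) (C : Type) (n : nat) :=
  gen_choiceMixin (formula L C n).

Definition scons (T : Type) (n : nat) (x : T) (e : 'I_n -> T) : 'I_n.+1 -> T :=
  fun i => if unlift ord0 i is Some j then e j else x.

Fixpoint teval (R : realType) (L : signature R) (C : Type) (N : mstructure L)
    (c : C -> N) (n : nat) (e : 'I_n -> N) (t : term L C n) : N :=
  match t with
  | Var i => e i
  | Par a => c a
  | App f ts => finterp (fun i => teval c e (ts i))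
  end.

Fixpoint eval (R : realType) (L : signature R) (C : Type) (N : mstructure L)
    (c : C -> N) (n : nat) (phi : formula L C n) : ('I_n -> N) -> R :=
  match phi in formula _ _ m return ('I_m -> N) -> R with
  | Fdist _ s t => fun e => mdist (teval c e s) (teval c e t)
  | Fpred _ P ts => fun e => pinterp (fun i => teval c e (ts i))
  | Fconn _ _ u _ phis => fun e => u (\row_i eval c (phis i) e)
  | Fsup _ psi => fun e => sup (range (fun x : N => eval c psi (scons x e)))
  | Finf _ psi => fun e => inf (range (fun x : N => eval c psi (scons x e)))
  end.

Definition no_var (T : Type) : 'I_0 -> T :=
  fun i => False_rect T (notF (ltn_ord i)).

(** * Models over a parameter set *)

(* For [A : set M], "(N, iota a)_{a in A} has the same theory as (M, a)_{a in A}". *)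
Definition elementary (R : realType) (L : signature R) (M : mstructure L)
    (A : set M) (N : mstructure L) (iota : A -> N) : Prop :=
  forall phi : formula L A 0,
    eval iota phi (@no_var N) = eval (fun a : A => set_val a) phi (@no_var M).

Record model_over (R : realType) (L : signature R) (M : mstructure L)
    (A : set M) := ModelOver {
  model :> mstructure L;
  emb : A -> model;
  emb_elementary : elementary emb
}.

Definition self_model (R : realType) (L : signature R) (M : mstructure L)
    (A : set M) : model_over A :=
  @ModelOver R L M A M (fun a : A => set_val a) (fun _ => erefl).

(** * Monster models *)

(* The cardinal kappa is represented by a type K: [small K A] is |A| < |K|. *)
Definition small (K T : Type) (A : set T) : Prop := ~ ([set: K] #<= A).

Definition saturated (R : realType) (L : signature R) (K : Type)
    (M : mstructure L) : Prop :=
  forall A : set M, small K A ->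
  forall (n : nat) (G : set (formula L A n)),
    (forall G0 : set (formula L A n), G0 `<=` G -> finite_set G0 ->
       exists b : 'rV[M]_n, forall phi, G0 phi ->
         eval (emb (self_model A)) phi (b ord0) = 0) ->
    exists b : 'rV[M]_n, forall phi, G phi ->
      eval (emb (self_model A)) phi (b ord0) = 0.

Definition automorphism (R : realType) (L : signature R) (M : mstructure L)
    (g : M -> M) : Prop :=
  [/\ bijective g,
      forall x y, mdist (g x) (g y) = mdist x y,
      forall (f : fsym L) (x : 'I_(farity f) -> M),
        g (finterp x) = finterp (fun i => g (x i)) &
      forall (P : psym L) (x : 'I_(parity P) -> M),
        pinterp (fun i => g (x i)) = pinterp x].

Definition strongly_homogeneous (R : realType) (L : signature R) (K : Type)
    (M : mstructure L) : Prop :=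
  forall A : set M, small K A ->
  forall f : A -> M, elementary f ->
    exists2 g : M -> M, automorphism g & forall a : A, g (set_val a) = f a.

Definition monster (R : realType) (L : signature R) (K : Type)
    (M : mstructure L) : Prop :=
  [/\ small K [set: nat],
      small K [set: fsym L] /\ small K [set: psym L],
      saturated K M &
      strongly_homogeneous K M].

(** * Type spaces *)

Section TypeSpace.
Context (R : realType) (L : signature R) (M : mstructure L) (A : set M).
Context (n : nat).

Definition type_of (N : model_over A) (b : 'rV[N]_n) :
    {ptws formula L A n -> R} :=
  fun phi => eval (@emb _ _ _ _ N) phi (b ord0).

(* S_n(A): a complete type is the type of some tuple in some model containing
   A.  The topology, inherited from the pointwise one, is the logic topology. *)
Definition stype : Type :=
  set_type [set p | exists (N : model_over A) (b : 'rV[N]_n), p = type_of b].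

Lemma type_of_complete (N : model_over A) (b : 'rV[N]_n) :
  type_of b \in [set p | exists (N : model_over A) (b : 'rV[N]_n),
                           p = type_of b].
Proof. by apply/mem_set; exists N, b. Qed.

Definition tp (N : model_over A) (b : 'rV[N]_n) : stype :=
  SigSub (type_of_complete b).

Definition realizations (N : model_over A) (F : set stype) : set 'rV[N]_n :=
  [set b | F (tp b)].

(* d(p, q) and d(q, D), computed in M; the infimum of the empty set is +oo. *)
Definition tuple_dist (a b : 'rV[M]_n) : R :=
  \big[Num.max/0]_(i < n) mdist (a ord0 i) (b ord0 i).

Definition type_dist (p q : stype) : \bar R :=
  ereal_inf [set d | exists a b : 'rV[M]_n,
    [/\ @tp (self_model A) a = p, @tp (self_model A) b = q &
        d = (tuple_dist a b)%:E]].

Definition set_dist (q : stype) (D : set stype) : \bar R :=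
  ereal_inf [set type_dist q p | p in D].

Definition definable (D : set stype) : Prop :=
  closed D /\
  forall e : R, 0 < e ->
    exists U : set stype,
      [/\ open U, D `<=` U & U `<=` [set q | (set_dist q D < e%:E)%E]].

Definition zeroset (F : set stype) : Prop :=
  exists2 phi : stype -> R, continuous phi & F = [set p | phi p = 0].

Definition algebraic (F : set stype) : Prop :=
  forall N : model_over A, compact (realizations (N := N) F).

Definition minimal (D : set stype) : Prop :=
  [/\ definable D,
      ~ algebraic D &
      forall F G : set stype, zeroset F -> zeroset G ->
        F `<=` D -> G `<=` D -> F `&` G = set0 ->
        ~ (~ algebraic F /\ ~ algebraic G)].

End TypeSpace.

Arguments realizations {R L M A n} N F.

(* Subsets of S_n(A) and S_n(B) are the same definable set when they have the
   same realizations in the monster model M. *)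
Definition strongly_minimal (R : realType) (L : signature R) (K : Type)
    (M : mstructure L) (A : set M) (n : nat) (D : set (stype A n)) : Prop :=
  definable D /\
  forall (B : set M) (E : set (stype B n)), small K B -> definable E ->
    realizations (self_model B) E = realizations (self_model A) D ->
    minimal E.

(** * Algebraic closure and pregeometries *)

(* The n-tuples algebraic over B. *)
Definition acl (R : realType) (L : signature R) (M : mstructure L) (n : nat)
    (B : set M) : set 'rV[M]_n :=
  [set b | algebraic [set @tp R L M B n (self_model B) b]].

Definition coordinates (T : Type) (n : nat) (X : set 'rV[T]_n) : set T :=
  [set t | exists2 x, X x & exists i, t = x ord0 i].

(* X |-> acl(XA), restricted to the realizations of D in M. *)
Definition acl_on (R : realType) (L : signature R) (M : mstructure L)
    (A : set M) (n : nat) (D : set (stype A n)) (X : set 'rV[M]_n) :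
    set 'rV[M]_n :=
  acl (coordinates X `|` A) `&` realizations (self_model A) D.

Record pregeometry (T : Type) (E : set T) (cl : set T -> set T) : Prop := {
  cl_sub : forall X, X `<=` E -> cl X `<=` E;
  cl_extensive : forall X, X `<=` E -> X `<=` cl X;
  cl_monotone : forall X Y, Y `<=` E -> X `<=` Y -> cl X `<=` cl Y;
  cl_idempotent : forall X, X `<=` E -> cl (cl X) = cl X;
  cl_exchange : forall X a b, X `<=` E -> E a -> E b ->
    cl (X `|` [set b]) a -> ~ cl X a -> cl (X `|` [set a]) b
}.

Definition finite_character (T : Type) (E : set T) (cl : set T -> set T) :
    Prop :=
  forall X a, X `<=` E -> cl X a ->
    exists X0, [/\ finite_set X0, X0 `<=` X & cl X0 a].

(* Main.v *)
(** Let [C] contain [A].  By strong minimality, if [phi] is a formula over [C] and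
    [r < s], then one of [phi <= r] and [phi >= s] cuts out a compact subset of the
    realizations of [D] in the monster model [M].  Hence all formulas over [C]
    converge along a separated sequence of realizations of [D]; the limit is the only
    non-algebraic type over [C] in [D], the generic one, and [a] is algebraic over
    [C] iff [phi a < r] with [phi <= r] compact for some [phi] over [C].  As [phi]
    mentions finitely many elements of [C], this gives finite character, and it
    reduces everything else to small [C].  Since [C] may be as large as [M], a
    noncompact set of realizations of the generic type has to be found outside [M]:
    it lives in the ultrapower of [M], as the shifts of the separated sequence.
    Transitivity and exchange are then the classical counting arguments, with
    compact sets for finite sets, finite nets and numbers of separated elements for
    cardinals, and automorphisms of [M] to move parameters. *)

From HB Require Import structures.
From mathcomp Require Import all_boot all_order all_algebra.
From mathcomp Require Import all_classical all_reals all_analysis.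
From mathcomp Require Import lra.
Require Import Defs.
Set Implicit Arguments.
Unset Strict Implicit.
Unset Printing Implicit Defensive.

Import Order.TTheory GRing.Theory Num.Theory.
Import numFieldTopology.Exports numFieldNormedType.Exports.

Local Open Scope classical_set_scope.
Local Open Scope ring_scope.

(** * Formulas *)

(** A condition [phi <= r] has no complement among closed conditions, so minimality is applied with
    a gap: for [r < s], the parts of [D] where [phi <= r] and where [phi >= s] are disjoint, and
    they are zerosets as soon as [D] is one, which Urysohn functions provide for a definable set.
    Viewing [D] over a larger small parameter set requires its definability there, obtained by
    moving tuples with automorphisms. Compactness has to pass from one model to another. In a
    complete space, a closed set is noncompact iff for some [e > 0] it contains an infinite sequence
    of pairwise [e]-separated points. Finite pieces of such a sequence are described by formulas and
    are copied into the monster by saturation. The same [e] survives the passage to shifts in the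
    ultrapower and from there to generic elements of the monster, so that counting separated points
    makes sense throughout. *)

Section SupRange.
Context (R : realType) (T : Type).
Implicit Types f g : T -> R.

Lemma sup_range_ub f b x : (forall x, `|f x| <= b) -> f x <= sup (range f).
Proof.
move=> fb; apply: ub_le_sup; last by exists x.
by exists b => _ [y _ <-]; apply: le_trans (fb y); rewrite ler_norm.
Qed.

Lemma sup_range_le f c : inhabited T -> (forall x, f x <= c) ->
  sup (range f) <= c.
Proof.
move=> [x0] fc; apply: ge_sup; first by exists (f x0), x0.
by move=> _ [y _ <-].
Qed.

Lemma sup_range_adherent f b e : inhabited T -> (forall x, `|f x| <= b) ->
  0 < e -> exists x, sup (range f) - e < f x.
Proof.
move=> [x0] fb e0; have hs : has_sup (range f).
  split; first by exists (f x0), x0.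
  by exists b => _ [y _ <-]; apply: le_trans (fb y); rewrite ler_norm.
by have [_ [x _ <-] h] := sup_adherent e0 hs; exists x.
Qed.

Lemma sup_range_norm f b : inhabited T -> (forall x, `|f x| <= b) ->
  `|sup (range f)| <= b.
Proof.
move=> iT fb; have [x0] := iT; rewrite ler_norml; apply/andP; split.
  apply: le_trans (sup_range_ub x0 fb).
  by have := fb x0; rewrite ler_norml => /andP[].
by apply: sup_range_le => // x; apply: le_trans (fb x); rewrite ler_norm.
Qed.

Lemma sup_range_dist f g b e : inhabited T ->
  (forall x, `|f x| <= b) -> (forall x, `|g x| <= b) ->
  (forall x, `|f x - g x| <= e) -> `|sup (range f) - sup (range g)| <= e.
Proof.
move=> iT fb gb fg; rewrite ler_norml; apply/andP; split.
  suff : sup (range g) <= sup (range f) + e by lra.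
  apply: sup_range_le => // x; have := sup_range_ub x fb.
  by have := fg x; rewrite ler_norml => /andP[]; lra.
suff : sup (range f) <= sup (range g) + e by lra.
apply: sup_range_le => // x; have := sup_range_ub x gb.
by have := fg x; rewrite ler_norml => /andP[]; lra.
Qed.

Lemma inf_rangeE f : inf (range f) = - sup (range (fun x => - f x)).
Proof. by rewrite /inf image_comp. Qed.

Lemma inf_range_dist f g b e : inhabited T ->
  (forall x, `|f x| <= b) -> (forall x, `|g x| <= b) ->
  (forall x, `|f x - g x| <= e) -> `|inf (range f) - inf (range g)| <= e.
Proof.
move=> iT fb gb fg; rewrite !inf_rangeE -opprD normrN.
apply: (@sup_range_dist _ _ b) => // x; rewrite ?normrN//.
by rewrite -opprD normrN.
Qed.

End SupRange.

(** * Substitution in terms and formulas *)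

Section Syntax.
Context (R : realType) (L : signature R).

Fixpoint tsubst (C C' : Type) n m (s : 'I_n -> term L C' m)
    (t : C -> term L C' m) (u : term L C n) : term L C' m :=
  match u with
  | Var i => s i
  | Par a => t a
  | App f us => App (fun i => tsubst s t (us i))
  end.

Definition tlift (C : Type) n : term L C n -> term L C n.+1 :=
  tsubst (fun i => Var L C (lift ord0 i)) (fun a => Par L n.+1 a).

Definition slift (C : Type) n m (s : 'I_n -> term L C m) :
    'I_n.+1 -> term L C m.+1 :=
  fun i => if unlift ord0 i is Some j then tlift (s j) else Var L C ord0.

(** Constants are substituted together with variables: this later turns parameters into variables
    and back, and changes the set of parameters. The target arity [m] is quantified inside the
    recursion because it grows under a quantifier. *)
Fixpoint fsubst (C C' : Type) n (phi : formula L C n) :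
    forall m, ('I_n -> term L C' m) -> (C -> term L C' m) -> formula L C' m :=
  match phi in formula _ _ n
    return forall m, ('I_n -> term L C' m) -> (C -> term L C' m) ->
      formula L C' m with
  | Fdist _ u v => fun m s t => Fdist (tsubst s t u) (tsubst s t v)
  | Fpred _ P us => fun m s t => Fpred (fun i => tsubst s t (us i))
  | Fconn _ _ u cu phis => fun m s t =>
      Fconn cu (fun i => fsubst (phis i) s t)
  | Fsup _ psi => fun m s t =>
      Fsup (fsubst psi (slift s) (fun a => tlift (t a)))
  | Finf _ psi => fun m s t =>
      Finf (fsubst psi (slift s) (fun a => tlift (t a)))
  end.

Context (N : mstructure L).

Lemma teval_tsubst (C C' : Type) (c : C' -> N) n m (s : 'I_n -> term L C' m)
    (t : C -> term L C' m) e u :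
  teval c e (tsubst s t u) =
  teval (fun a => teval c e (t a)) (fun i => teval c e (s i)) u.
Proof.
by elim: u => //= f us IH; congr finterp; apply/funext => i.
Qed.

Lemma scons_lift (T : Type) n (x : T) (v : 'I_n -> T) i :
  scons x v (lift ord0 i) = v i.
Proof. by rewrite /scons liftK. Qed.

Lemma teval_tlift (C : Type) (c : C -> N) n x (e : 'I_n -> N) u :
  teval c (scons x e) (tlift u) = teval c e u.
Proof.
rewrite teval_tsubst /=; congr teval; apply/funext => i.
exact: scons_lift.
Qed.

Lemma teval_slift (C : Type) (c : C -> N) n m x e (s : 'I_n -> term L C m) :
  (fun i => teval c (scons x e) (slift s i)) =
  scons x (fun i => teval c e (s i)).
Proof.
apply/funext => i; rewrite /slift /scons; case: unliftP => [j _|_] /=.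
  by rewrite teval_tlift.
by rewrite unlift_none.
Qed.

Lemma eval_fsubst (C C' : Type) (c : C' -> N) n (phi : formula L C n) m
    (s : 'I_n -> term L C' m) (t : C -> term L C' m) e :
  eval c (fsubst phi s t) e =
  eval (fun a => teval c e (t a)) phi (fun i => teval c e (s i)).
Proof.
elim: phi m s t e => [n' u v|n' P us|n' k u cu phis IH|n' psi IH|n' psi IH] m
  s t e /=.
- by rewrite !teval_tsubst.
- by congr pinterp; apply/funext => i; rewrite teval_tsubst.
- by congr u; apply/rowP => i; rewrite !mxE IH.
- congr sup; apply: eq_imagel => x _; rewrite IH teval_slift.
  by congr (eval _ psi _); apply/funext => a; rewrite teval_tlift.
- congr inf; apply: eq_imagel => x _; rewrite IH teval_slift.
  by congr (eval _ psi _); apply/funext => a; rewrite teval_tlift.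
Qed.

Definition fmap (C C' : Type) n (f : C -> C') (phi : formula L C n) :
    formula L C' n :=
  fsubst phi (fun i => Var L C' i) (fun a => Par L n (f a)).

Lemma eval_fmap (C C' : Type) (c : C' -> N) (f : C -> C') n
    (phi : formula L C n) e : eval c (fmap f phi) e = eval (c \o f) phi e.
Proof. exact: eval_fsubst. Qed.

End Syntax.

Section Continuity.

(** * Boundedness and uniform continuity of formulas *)

Context (R : realType) (L : signature R) (N : mstructure L).

Lemma pinterp_norm (P : psym L) (x : 'I_(parity P) -> N) :
  `|pinterp x| <= Num.max `|pmin P| `|pmax P|.
Proof.
have /andP[h1 h2] := pinterp_bounded x.
rewrite le_max; have [h|h] := leP 0 (pinterp x).
  by rewrite ger0_norm//; apply/orP; right; rewrite (le_trans h2)// ler_norm.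
rewrite ltr0_norm//; apply/orP; left.
by rewrite -normrN (le_trans _ (ler_norm _))// lerN2.
Qed.

(** A connective is merely continuous, so its bound comes from the compact box containing the values
    of its arguments. The bound does not depend on [c] either: in the ultrapower the constants are
    interpreted by sequences, and the values at all indices must stay in one bounded interval. *)
Lemma eval_bounded (C : Type) n (phi : formula L C n) :
  exists b : R, forall (c : C -> N) e, `|eval c phi e| <= b.
Proof.
elim: phi => {n} [n u v|n P us|n k u cu phis IH|n psi [b IH]|n psi [b IH]] /=.
- exists (diameter L) => c e; rewrite ger0_norm ?mdist_ge0//.
  exact: (carrier_bounded (m := N)).
- by exists (Num.max `|pmin P| `|pmax P|) => c e; exact: pinterp_norm.
- have [b hb] := choice IH.
  pose K := [set v : 'rV[R]_k | forall i, `[- b i, b i]%classic (v ord0 i)].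
  have cK : compact K.
    apply: (@rV_compact _ _ (fun i => `[- b i, b i]%classic)) => i.
    exact: segment_compact.
  have : compact (u @` K).
    by apply: continuous_compact => //; exact: continuous_subspaceT.
  move=> /compact_bounded [B [_ hB]]; exists (B + 1) => c e.
  apply: (hB (B + 1)); first by rewrite ltrDl.
  exists (\row_i eval c (phis i) e) => // i /=.
  by rewrite mxE in_itv/= -ler_norml.
- by exists b => c e; apply: sup_range_norm => //; exact: carrier_inhabited.
- exists b => c e; rewrite inf_rangeE normrN.
  by apply: sup_range_norm => [|x]; rewrite ?normrN//; exact: carrier_inhabited.
Qed.

Lemma fin_pos (I : finType) (P : I -> R -> Prop) :
  (forall i d d', P i d -> 0 < d' -> d' <= d -> P i d') ->
  (forall i, exists2 d, 0 < d & P i d) ->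
  exists2 d, 0 < d & forall i, P i d.
Proof.
move=> mono exP; have /choice[d dP] : forall i, exists d, 0 < d /\ P i d.
  by move=> i; have [d] := exP i; exists d.
have d0 : 0 < \big[Num.min/1]_i d i by apply: lt_bigmin => // i _; case: (dP i).
exists (\big[Num.min/1]_i d i) => // i.
by apply: mono (dP i).2 d0 _; exact: bigmin_le.
Qed.

Lemma teval_unif_continuous (C : Type) (c : C -> N) n (t : term L C n) d :
  0 < d -> exists2 d', 0 < d' & forall e e' : 'I_n -> N,
    (forall i, mdist (e i) (e' i) < d') -> mdist (teval c e t) (teval c e' t) < d.
Proof.
elim: t d => [i|a|f us IH] d d0 /=.
- by exists d.
- by exists 1 => // e e' _; rewrite mdistxx.
- have d2 : 0 < d / 2 by lra.
  have [|dl dl0 hd] := fin_pos _ (fun i => IH i _ (@fmodulus_gt0 R L f _ d2)).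
    move=> i x y h y0 yx e e' he; apply: h => j.
    by apply: lt_le_trans (he j) yx.
  exists dl => // e e' he; apply: (@le_lt_trans _ _ (d / 2)); last by lra.
  by apply: finterp_uc => // i; exact: hd.
Qed.

(** Heine-Cantor through near-coverings: a radius that works at a point, once halved, works for all
    nearby points, and compactness makes one radius work on all of [K]. *)
Lemma compact_unif_continuous k (u : 'rV[R]_k -> R) (K : set 'rV[R]_k)
    (e : R) :
  continuous u -> compact K -> 0 < e ->
  exists2 d : R, 0 < d & forall x y : 'rV[R]_k, K x ->
    (forall i, `|x ord0 i - y ord0 i| < d) ->
    `|u x - u y| <= e.
Proof.
move=> cu /compact_near_coveringP cK e0.
have e2 : 0 < e / 2 by lra.
pose P (d : R) (x : 'rV[R]_k) := forall y : 'rV[R]_k,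
  (forall i, `|x ord0 i - y ord0 i| < d) -> `|u x - u y| <= e.
have : \forall d \near (0:R)^'+, K `<=` P d.
  apply: cK => x _.
  have /cvgrPdist_le /(_ _ e2) /nbhs_ballP[d /= d0 hd] := cu x.
  have d2 : 0 < d / 2 by lra.
  exists (ball x (d / 2), [set r | r < d / 2]).
    split; first exact: nbhsx_ballx.
    exact: nbhs_right_lt.
  move=> [x' r] /= [[_ xx'] rd] y x'y.
  have xx'' : ball x d x' by split=> // i j; apply: le_ball (xx' i j); lra.
  have xy : ball x d y.
    split=> // i j; have := xx' i j; have := x'y j; rewrite !ord1.
    rewrite /ball /= => h1 h2.
    rewrite (_ : _ - _ = (x ord0 j - x' ord0 j) + (x' ord0 j - y ord0 j)).
      by rewrite (le_lt_trans (ler_normD _ _))//; lra.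
    by rewrite addrA subrK.
  rewrite (_ : _ - _ = (u x - u y) - (u x - u x')); last by lra.
  rewrite (le_trans (ler_normB _ _))//.
  by have := hd _ xy; have := hd _ xx''; lra.
move=> hK; have [d [hd d0]] : exists d : R, K `<=` P d /\ 0 < d.
  by apply: (@filter_ex _ (0:R)^'+); apply: filterI => //; exact: nbhs_right_gt.
by exists d => // x y Kx; exact: hd.
Qed.

(** A quantifier keeps the modulus of its body: both environments are extended by the same value,
    and suprema or infima of uniformly close functions are close. *)
Lemma eval_unif_continuous (C : Type) (c : C -> N) n (phi : formula L C n) (d : R) :
  0 < d -> exists2 d', 0 < d' & forall e e' : 'I_n -> N,
    (forall i, mdist (e i) (e' i) < d') -> `|eval c phi e - eval c phi e'| <= d.
Proof.
elim: phi d => {n} [n u v|n P us|n k u cu phis IH|n psi IH|n psi IH] d d0 /=.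
- have d2 : 0 < d / 2 by lra.
  have [r r0 hr] := teval_unif_continuous c u d2.
  have [s s0 hs] := teval_unif_continuous c v d2.
  exists (Num.min r s) => [|e e' he]; first by rewrite lt_min r0 s0.
  have /hr h1 i : mdist (e i) (e' i) < r.
    by apply: lt_le_trans (he i) _; rewrite ge_min lexx.
  have /hs h2 i : mdist (e i) (e' i) < s.
    by apply: lt_le_trans (he i) _; rewrite ge_min lexx orbT.
  have t1 := metric_triangle (teval c e u) (teval c e' u) (teval c e v).
  have t2 := metric_triangle (teval c e' u) (teval c e' v) (teval c e v).
  have t3 := metric_triangle (teval c e' u) (teval c e u) (teval c e' v).
  have t4 := metric_triangle (teval c e u) (teval c e v) (teval c e' v).
  rewrite (metric_sym (teval c e' u) (teval c e u)) in t3.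
  rewrite (metric_sym (teval c e' v) (teval c e v)) in t2.
  by rewrite ler_norml; apply/andP; split; lra.
- have [|dl dl0 hd] := fin_pos _
    (fun i => teval_unif_continuous c (us i) (@pmodulus_gt0 R L P _ d0)).
    move=> i x y h y0 yx e e' he; apply: h => j.
    by apply: lt_le_trans (he j) yx.
  by exists dl => // e e' he; apply: pinterp_uc => // i; exact: hd.
- have /choice[b hb] i := eval_bounded (phis i).
  pose K := [set v : 'rV[R]_k | forall i, `[- b i, b i]%classic (v ord0 i)].
  have cK : compact K.
    apply: (@rV_compact _ _ (fun i => `[- b i, b i]%classic)) => i.
    exact: segment_compact.
  have [r r0 hr] := compact_unif_continuous cu cK d0.
  have r2 : 0 < r / 2 by lra.
  have [|dl dl0 hd] := fin_pos _ (fun i => IH i _ r2).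
    move=> i x y h y0 yx e e' he; apply: h => j.
    by apply: lt_le_trans (he j) yx.
  exists dl => // e e' he; apply: hr => i; rewrite mxE.
    by rewrite /= in_itv/= -ler_norml.
  by rewrite mxE; apply: (@le_lt_trans _ _ (r / 2)); [exact: hd|lra].
- have [r r0 hr] := IH _ d0; have [b hb] := eval_bounded psi.
  exists r => // e e' he; apply: (@sup_range_dist _ _ _ _ b) => // [|x].
    exact: carrier_inhabited.
  by apply: hr => i; rewrite /scons; case: unliftP => // _; rewrite mdistxx.
- have [r r0 hr] := IH _ d0; have [b hb] := eval_bounded psi.
  exists r => // e e' he; apply: (@inf_range_dist _ _ _ _ b) => // [|x].
    exact: carrier_inhabited.
  by apply: hr => i; rewrite /scons; case: unliftP => // _; rewrite mdistxx.
Qed.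

End Continuity.

(** * Finite support of formulas in the parameters *)

Section ParamSupport.
Context (R : realType) (L : signature R) (M : mstructure L).

Definition incl (B C : set M) (BC : B `<=` C) (b : B) : C :=
  SigSub (mem_set (BC _ (set_valP b))).

(** The property is asked of every [S'] containing [S], so that the supports of the finitely many
    arguments of a symbol or connective can be replaced by their union. *)
Lemma finite_params_family (C : set M) (I : finType)
    (P : I -> set M -> Prop) :
  (forall i, exists2 S : set M, finite_set S /\ S `<=` C &
    forall S', S `<=` S' -> P i S') ->
  exists2 S : set M, finite_set S /\ S `<=` C &
    forall S', S `<=` S' -> forall i, P i S'.
Proof.
move=> h; have /choice[S hS] : forall i, exists S : set M,
    (finite_set S /\ S `<=` C) /\ forall S', S `<=` S' -> P i S'.
  by move=> i; have [S h1 h2] := h i; exists S.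
exists (\bigcup_i S i) => [|S' hS' i].
  split; first by apply: bigcup_finite => // i _; case: (hS i) => -[].
  by move=> x [i _]; case: (hS i) => -[_ hi] _; exact: hi.
by apply: (hS i).2 => x Sx; apply: hS'; exists i.
Qed.

Lemma term_finite_params (C : set M) n (u : term L C n) :
  exists2 S : set M, finite_set S /\ S `<=` C &
    forall S', S `<=` S' -> exists u' : term L S' n, forall e : 'I_n -> M,
      teval set_val e u' = teval set_val e u.
Proof.
elim: u => [i|a|f us IH].
- by exists set0 => [|S' _]; [split|exists (Var L S' i)].
- exists [set set_val a] => [|S' h].
    by split=> // _ ->; exact: set_valP.
  by exists (Par L n (SigSub (mem_set (h _ erefl)))).
- have [S fS hS] := finite_params_family IH; exists S => // S' /hS /choice[us' h].
  by exists (App us') => e /=; congr finterp; apply/funext => i; exact: h.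
Qed.

Lemma formula_finite_params (C : set M) n (phi : formula L C n) :
  exists2 S : set M, finite_set S /\ S `<=` C &
    forall S', S `<=` S' -> exists phi' : formula L S' n, forall e : 'I_n -> M,
      eval set_val phi' e = eval set_val phi e.
Proof.
elim: phi => {n} [n u v|n P us|n k u cu phis IH|n psi [S fS IH]|n psi [S fS IH]].
- have [S [fS SC] hS] := term_finite_params u.
  have [T [fT TC] hT] := term_finite_params v.
  exists (S `|` T); first by rewrite finite_setU; split=> // x [/SC|/TC].
  move=> S' h; have [u' hu] := hS S' (fun x Sx => h x (or_introl Sx)).
  have [v' hv] := hT S' (fun x Sx => h x (or_intror Sx)).
  by exists (Fdist u' v') => e /=; rewrite hu hv.
- have [S fS hS] := finite_params_family (fun i => term_finite_params (us i)).
  exists S => // S' /hS h.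
  have /choice[us' hus] := h.
  by exists (Fpred us') => e /=; congr pinterp; apply/funext => i; exact: hus.
- have [S fS hS] := finite_params_family IH; exists S => // S' /hS /choice[p hp].
  by exists (Fconn cu p) => e /=; congr u; apply/rowP => i; rewrite !mxE hp.
- exists S => // S' /IH[p hp]; exists (Fsup p) => e /=.
  by congr sup; apply: eq_imagel => x _.
- exists S => // S' /IH[p hp]; exists (Finf p) => e /=.
  by congr inf; apply: eq_imagel => x _.
Qed.

End ParamSupport.

(** * Ultrapowers along the natural numbers *)

Definition nat_ultra : set_system nat :=
  sval (cid (ultraFilterLemma eventually_filter)).

#[global] Instance nat_ultra_ultra : UltraFilter nat_ultra.
Proof. by rewrite /nat_ultra; case: cid => U []. Qed.

Lemma nat_ultra_ge k : \forall j \near nat_ultra, (k <= j)%N.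
Proof.
rewrite /nat_ultra; case: cid => U [_ sU] /=; apply: sU.
exact: nbhs_infty_ge.
Qed.

Lemma ultra_bounded_cvg (R : realType) (T : Type) (F : set_system T)
    (f : T -> R) (b : R) : UltraFilter F -> (forall x, `|f x| <= b) ->
  exists l : R, f @ F --> l.
Proof.
move=> FU fb.
have fK : (f @ F) `[- b, b]%classic.
  have aU : forall x, `[- b, b]%classic (f x).
    by move=> x; rewrite /= in_itv/= -ler_norml.
  by apply: (@filterE _ F) => x; exact: aU.
have [p [_ clp]] := @segment_compact R (- b) b (f @ F) _ fK.
exists p => V Vp; have [//|nV] := in_ultra_setVsetC (f @^-1` V) FU.
have /clp/(_ Vp) : (f @ F) (~` V) by [].
by case=> x [].
Qed.

Section UltraLimit.
Context (R : realType).
Implicit Types (f g : nat -> R).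

Definition ulim f : R := lim (f @ nat_ultra).

Lemma ulim_cvg f b : (forall j, `|f j| <= b) -> f @ nat_ultra --> ulim f.
Proof.
by move=> fb; apply/cvg_ex; exact: ultra_bounded_cvg fb.
Qed.

Lemma ulim_le f b c : (forall j, `|f j| <= b) ->
  (\forall j \near nat_ultra, f j <= c) -> ulim f <= c.
Proof. by move=> /ulim_cvg; exact: cvgr_to_le. Qed.

Lemma ulim_ge f b c : (forall j, `|f j| <= b) ->
  (\forall j \near nat_ultra, c <= f j) -> c <= ulim f.
Proof. by move=> /ulim_cvg; exact: cvgr_to_ge. Qed.

Lemma ulim_mono f g b : (forall j, `|f j| <= b) -> (forall j, `|g j| <= b) ->
  (\forall j \near nat_ultra, f j <= g j) -> ulim f <= ulim g.
Proof.
by move=> /ulim_cvg fl /ulim_cvg gl fg; exact: (ler_cvg_to fl gl).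
Qed.

Lemma ulim_lt f b c : (forall j, `|f j| <= b) -> ulim f < c ->
  \forall j \near nat_ultra, f j < c.
Proof. by move=> /ulim_cvg fl; exact: cvgr_lt. Qed.

Lemma ulimE f b l : (forall j, `|f j| <= b) ->
  (forall e, 0 < e -> \forall j \near nat_ultra, `|f j - l| <= e) -> ulim f = l.
Proof.
move=> fb h; apply/eqP; rewrite eq_le; apply/andP; split.
  apply/ler_addgt0Pl => e e0; apply: ulim_le fb _.
  by apply: filterS (h _ e0) => j; rewrite ler_norml => /andP[]; lra.
apply/ler_addgt0Pl => e e0; rewrite -lerBlDl; apply: ulim_ge fb _.
by apply: filterS (h _ e0) => j; rewrite ler_norml => /andP[]; lra.
Qed.

Lemma ulim_dist f g b e : (forall j, `|f j| <= b) -> (forall j, `|g j| <= b) ->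
  (\forall j \near nat_ultra, `|f j - g j| <= e) -> `|ulim f - ulim g| <= e.
Proof.
move=> fb gb fg; have fl := ulim_cvg fb; have gl := ulim_cvg gb.
have : (fun j => `|f j - g j|) @ nat_ultra --> `|ulim f - ulim g|.
  by apply: cvg_norm; exact: cvgB.
by move=> /cvgr_to_le; apply.
Qed.

End UltraLimit.

(** * The ultrapower as a complete metric space *)

Section Ultrapower.
Context (R : realType) (L : signature R) (M : mstructure L).

Definition udist (x y : nat -> M) : R := ulim (fun j => mdist (x j) (y j)).

Lemma mdist_bounded (x y : M) : `|mdist x y| <= diameter L.
Proof. by rewrite ger0_norm ?mdist_ge0//; exact: (carrier_bounded (m := M)). Qed.

Let bounded_dist (x y : nat -> M) j : `|mdist (x j) (y j)| <= diameter L.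
Proof. exact: mdist_bounded. Qed.

Lemma udist_le x y c : (\forall j \near nat_ultra, mdist (x j) (y j) <= c) ->
  udist x y <= c.
Proof. exact: (ulim_le (bounded_dist x y)). Qed.

Lemma udist_lt x y c : udist x y < c ->
  \forall j \near nat_ultra, mdist (x j) (y j) < c.
Proof. exact: (ulim_lt (bounded_dist x y)). Qed.

Lemma udist_ge0 x y : 0 <= udist x y.
Proof.
by apply: (ulim_ge (bounded_dist x y)); apply: nearW => j; exact: mdist_ge0.
Qed.

Lemma udist_eq0 x y : (forall e, 0 < e ->
  \forall j \near nat_ultra, mdist (x j) (y j) <= e) -> udist x y = 0.
Proof.
move=> h; apply/eqP; rewrite eq_le udist_ge0 andbT.
by apply/ler_addgt0Pl => e e0; rewrite addr0; apply: udist_le; exact: h.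
Qed.

Lemma udistxx x : udist x x = 0.
Proof.
by apply: udist_eq0 => e e0; apply: nearW => j; rewrite mdistxx ltW.
Qed.

Lemma udist_sym x y : udist x y = udist y x.
Proof. by congr ulim; apply/funext => j; rewrite metric_sym. Qed.

Lemma udist_triangle y x z : udist x z <= udist x y + udist y z.
Proof.
apply/ler_addgt0Pl => e e0; apply: udist_le.
have e2 : 0 < e / 2 by lra.
have h1 : udist x y < udist x y + e / 2 by lra.
have h2 : udist y z < udist y z + e / 2 by lra.
apply: filterS2 (udist_lt h1) (udist_lt h2) => j.
by have := metric_triangle (x j) (y j) (z j); lra.
Qed.

(** The quotient of the sequences by the pseudometric [udist]. Its points are the classes
    themselves, so that sequences at distance zero give equal points. *)
Record upow := UPow {
  uclass : set (nat -> M);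
  uclassP : exists x, uclass = [set y | udist x y = 0] }.

HB.instance Definition _ := gen_eqMixin upow.
HB.instance Definition _ := gen_choiceMixin upow.

Definition upi (x : nat -> M) : upow :=
  @UPow [set y | udist x y = 0] (ex_intro _ x erefl).

Definition urep (p : upow) : nat -> M := sval (cid (uclassP p)).

Lemma upow_eq p q : uclass p = uclass q -> p = q.
Proof.
case: p q => [A pA] [B pB] /= AB; rewrite AB in pA *.
by congr UPow; exact: Prop_irrelevance.
Qed.

Lemma urepK p : upi (urep p) = p.
Proof. by apply: upow_eq; rewrite /urep; case: cid. Qed.

Lemma upi_eq x y : udist x y = 0 -> upi x = upi y.
Proof.
move=> xy; apply: upow_eq; apply/seteqP; split => z /= h.
  apply/eqP; rewrite eq_le udist_ge0 andbT.
  by rewrite (le_trans (udist_triangle x y z))// (udist_sym y x) xy h addr0.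
apply/eqP; rewrite eq_le udist_ge0 andbT.
by rewrite (le_trans (udist_triangle y x z))// xy h addr0.
Qed.

Lemma udist_urep x : udist x (urep (upi x)) = 0.
Proof.
have : uclass (upi (urep (upi x))) = uclass (upi x) by rewrite urepK.
move=> /seteqP[_] /(_ x) /= h.
by rewrite udist_sym; apply: h; exact: udistxx.
Qed.

Let dist (p q : upow) := udist (urep p) (urep q).

Let distxx p : dist p p = 0. Proof. exact: udistxx. Qed.

Let dist_positivity p q : dist p q = 0 -> p = q.
Proof. by move=> /upi_eq; rewrite !urepK. Qed.

Let dist_sym p q : dist p q = dist q p. Proof. exact: udist_sym. Qed.

Let dist_triangle q p r : dist p r <= dist p q + dist q r.
Proof. exact: udist_triangle. Qed.

HB.instance Definition _ := @isMetric.Build R upow dist distxx dist_positivity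
  dist_sym dist_triangle.

Lemma mdist_urep (p q : upow) : mdist p q = udist (urep p) (urep q).
Proof. by []. Qed.

Lemma mdist_upi x y : mdist (upi x) (upi y) = udist x y.
Proof.
rewrite mdist_urep; set x' := urep _; set y' := urep _.
have xx' : udist x x' = 0 by exact: udist_urep.
have yy' : udist y y' = 0 by exact: udist_urep.
have := udist_triangle x x' y'; have := udist_triangle y x y'.
have := udist_triangle x' x y; have := udist_triangle y' x' y.
rewrite (udist_sym x' x) (udist_sym y' y) xx' yy' => h1 h2 h3 h4.
by apply/eqP; rewrite eq_le; apply/andP; split; lra.
Qed.

Lemma upow_inhabited : inhabited upow.
Proof. by have [x] := carrier_inhabited M; exists; exact: upi (fun=> x). Qed.

Lemma upow_bounded (p q : upow) : mdist p q <= diameter L.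
Proof.
apply: udist_le; apply: nearW => j.
by have := mdist_bounded (urep p j) (urep q j); rewrite ger0_norm ?mdist_ge0.
Qed.

(* A Cauchy filter is followed along points [x k]; the limit is a diagonal
   sequence, [z j] being [x m j] for the largest [m <= j] such that the first [m]
   consecutive distances at the index [j] are as small as expected. *)
Lemma upow_complete (F : set_system upow) :
  ProperFilter F -> cauchy F -> exists p : upow, F --> p.
Proof.
move=> FF /cauchyP Fc; pose h k : R := 2^-1 ^+ k.
have h0 k : 0 < h k by rewrite exprn_gt0// invr_gt0.
have hS k : h k = 2 * h k.+1 by rewrite /h exprS; lra.
have /choice[x hx] k : exists p : upow, F (ball p (h k)) by exact: Fc.
pose y k := urep (x k).
(* The balls around [x k] and [x k.+1] share a point, so these centres are closer than
   [h k + h k.+1], which is less than [2 * h k]. *)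
pose A k : set nat := [set j | mdist (y k j) (y k.+1 j) < 2 * h k].
have UA k : nat_ultra (A k).
  apply: udist_lt; have [p [pk pk']] := filter_ex (filterI (hx k) (hx k.+1)).
  move: pk pk'; rewrite !ballEmdist /= => pk pk'.
  have := metric_triangle (x k) p (x k.+1); rewrite (metric_sym p) mdist_urep.
  by have := hS k; have := h0 k.+1; rewrite -/(y k) -/(y k.+1); lra.
(* The bounds telescope because [2 * h l = 4 * (h l - h l.+1)]. *)
have dist_y j k i : (forall l, (l < k + i)%N -> A l j) ->
    mdist (y k j) (y (k + i)%N j) <= 4 * (h k - h (k + i)%N).
  elim: i => [|i IH] hl; first by rewrite addn0 mdistxx subrr mulr0.
  rewrite addnS; have := metric_triangle (y k j) (y (k + i)%N j) (y (k + i).+1 j).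
  have := IH (fun l lk => hl l (leq_trans lk (leq_add (leqnn _) (leqnSn _)))).
  have := hl (k + i)%N; rewrite addnS ltnSn => /(_ isT); rewrite /A /=.
  by have := hS (k + i)%N; lra.
have exm j : exists m, (forall l, (l < m)%N -> A l j) /\
    forall k, (k <= j)%N -> (forall l, (l < k)%N -> A l j) -> (k <= m)%N.
  elim: {2}j => [|n [m [h1 h2]]].
    by exists 0%N; split=> // k; rewrite leqn0 => /eqP ->.
  have [Hn|Hn] := pselect (forall l, (l < n.+1)%N -> A l j).
    by exists n.+1; split.
  exists m; split=> // k; rewrite leq_eqVlt => /orP[/eqP -> //|].
  exact: h2.
have /choice[m hm] := exm.
pose z j := y (m j) j.
have hz k : udist (y k) z <= 4 * h k.
  apply: udist_le.
  have UB : \forall j \near nat_ultra, forall l, (l < k)%N -> A l j.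
    elim: k => [|k IH].
      by apply: (@filterE _ nat_ultra) => j l; rewrite ltn0.
    apply: filterS2 IH (UA k) => j IH Ak l; rewrite ltnS leq_eqVlt.
    by move=> /orP[/eqP ->|/IH].
  apply: filterS2 UB (nat_ultra_ge k) => j hl kj.
  have [h1 h2] := hm j; have km := h2 _ kj hl.
  have := dist_y j k (m j - k)%N; rewrite subnKC// => /(_ h1).
  by have := h0 (m j); rewrite /z; lra.
exists (upi z); apply/cvg_ballP => e e0.
(* The fifth: [4 * h k] from the limit to [x k], and [h k] from [x k] to the points of the filter
   set. *)
have [k _ hk] : \forall k \near \oo, h k < e / 5.
  have /cvgr_lt : h @ \oo --> (0 : R).
    by apply: cvg_expr; rewrite ger0_norm; lra.
  by apply; lra.
have {}hk : h k < e / 5 by apply: hk => /=.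
apply: filterS (hx k) => p; rewrite !ballEmdist /= => xp.
have := metric_triangle (upi z) (x k) p.
have : mdist (upi z) (x k) <= 4 * h k.
  by rewrite -(urepK (x k)) mdist_upi udist_sym; exact: hz.
by lra.
Qed.

End Ultrapower.

(** * The structure on the ultrapower and Łoś's theorem *)

Section UltrapowerStructure.
Context (R : realType) (L : signature R) (M : mstructure L).
Notation upow := (upow M).

Definition upow_finterp (f : fsym L) (p : 'I_(farity f) -> upow) : upow :=
  upi (fun j => finterp (fun i => urep (p i) j)).

Lemma upow_finterp_uc (f : fsym L) (e : R) : 0 < e ->
  forall x y : 'I_(farity f) -> upow,
    (forall i, mdist (x i) (y i) < fmodulus f e) ->
    mdist (upow_finterp x) (upow_finterp y) <= e.
Proof.
move=> e0 x y xy; rewrite mdist_upi; apply: udist_le.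
have : \forall j \near nat_ultra,
    forall i, mdist (urep (x i) j) (urep (y i) j) < fmodulus f e.
  by apply: filter_forall => i; apply: udist_lt; exact: xy.
by apply: filterS => j; exact: finterp_uc.
Qed.

Definition upow_pinterp (P : psym L) (p : 'I_(parity P) -> upow) : R :=
  ulim (fun j => pinterp (fun i => urep (p i) j)).

Lemma upow_pinterp_bounded (P : psym L) (x : 'I_(parity P) -> upow) :
  pmin P <= upow_pinterp x <= pmax P.
Proof.
have xb j := pinterp_norm (fun i => urep (x i) j).
apply/andP; split.
  apply: (ulim_ge xb); apply: (@filterE _ nat_ultra) => j.
  by have /andP[] := pinterp_bounded (fun i => urep (x i) j).
apply: (ulim_le xb); apply: (@filterE _ nat_ultra) => j.
by have /andP[] := pinterp_bounded (fun i => urep (x i) j).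
Qed.

Lemma upow_pinterp_uc (P : psym L) (e : R) : 0 < e ->
  forall x y : 'I_(parity P) -> upow,
    (forall i, mdist (x i) (y i) < pmodulus P e) ->
    `|upow_pinterp x - upow_pinterp y| <= e.
Proof.
move=> e0 x y xy; apply: ulim_dist => [j|j|]; [exact: pinterp_norm..|].
have : \forall j \near nat_ultra,
    forall i, mdist (urep (x i) j) (urep (y i) j) < pmodulus P e.
  by apply: filter_forall => i; apply: udist_lt; exact: xy.
by apply: filterS => j; exact: pinterp_uc.
Qed.

Definition ultrapower : mstructure L :=
  MStructure (upow_inhabited M) (@upow_complete R L M) (@upow_bounded R L M)
    upow_finterp_uc upow_pinterp_bounded upow_pinterp_uc.

Lemma urep_near k (x : 'I_k -> nat -> M) (d : R) : 0 < d ->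
  \forall j \near nat_ultra,
    forall i, mdist (urep (upi (x i)) j) (x i j) < d.
Proof.
move=> d0; apply: filter_forall => i; apply: udist_lt.
by rewrite udist_sym udist_urep.
Qed.

(** The symbols act on the chosen representatives [urep], which agree with the given sequences only
    up to an arbitrarily small distance on a set of the ultrafilter; the modulus of the symbol
    absorbs the difference. *)
Lemma teval_ultrapower (C : Type) (c : C -> nat -> M) n (e : 'I_n -> nat -> M)
    (t : term L C n) :
  teval (N := ultrapower) (fun a => upi (c a)) (fun i => upi (e i)) t =
  upi (fun j => teval (c^~ j) (e^~ j) t).
Proof.
elim: t => //= f us IH; rewrite (funext IH).
apply: upi_eq; apply: udist_eq0 => d d0.
set x := fun i j => teval (c^~ j) (e^~ j) (us i).
apply: filterS (urep_near x (fmodulus_gt0 f d0)) => j.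
exact: finterp_uc.
Qed.

(** The quantifier step of Łoś's theorem: witnesses [x j] that are optimal up to [d] at each index
    form a sequence whose class is optimal up to [d] in the ultrapower. The second hypothesis says
    that the choice of a representative does not matter. *)
Lemma ulim_sup (g : nat -> M -> R) (b : R) : (forall j x, `|g j x| <= b) ->
  (forall x, ulim (fun j => g j (urep (upi x) j)) = ulim (fun j => g j (x j))) ->
  sup (range (fun p : upow => ulim (fun j => g j (urep p j)))) =
  ulim (fun j => sup (range (g j))).
Proof.
move=> gb gpi; have iM := carrier_inhabited M.
have sb j : `|sup (range (g j))| <= b by apply: sup_range_norm => //; exact: gb.
apply/eqP; rewrite eq_le; apply/andP; split.
  apply: sup_range_le => [|p]; first exact: upow_inhabited.
  apply: (@ulim_mono _ _ _ b) => //.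
  by apply: (@filterE _ nat_ultra) => j; exact: (@sup_range_ub _ _ (g j) b).
apply/ler_addgt0Pl => d d0.
have /choice[x hx] j : exists x, sup (range (g j)) - d < g j x.
  exact: (@sup_range_adherent _ _ (g j) b).
have xb : forall p : upow, `|ulim (fun j => g j (urep p j))| <= b.
  move=> p; rewrite ler_norml; apply/andP; split.
    apply: (@ulim_ge _ _ b) => //; apply: (@filterE _ nat_ultra) => j.
    by have := gb j (urep p j); rewrite ler_norml => /andP[].
  apply: (@ulim_le _ _ b) => //; apply: (@filterE _ nat_ultra) => j.
  by have := gb j (urep p j); rewrite ler_norml => /andP[].
have := sup_range_ub (upi x) xb; rewrite gpi => h.
suff : ulim (fun j => sup (range (g j))) - d <= ulim (fun j => g j (x j)) by lra.
rewrite lerBlDr.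
have -> : ulim (fun j => g j (x j)) + d = ulim (fun j => g j (x j) + d).
  symmetry; apply/cvg_lim => //; apply: cvgD; last exact: cvg_cst.
  by apply: (@ulim_cvg _ _ b) => j.
apply: (@ulim_mono _ _ _ (b + d)) => [j|j|].
- by rewrite (le_trans (sb j))// lerDl ltW.
- by rewrite (le_trans (ler_normD _ _))// (gtr0_norm d0) lerD2r.
- by apply: (@filterE _ nat_ultra) => j; rewrite -lerBlDr; exact/ltW/hx.
Qed.

Lemma ulimN (f : nat -> R) b : (forall j, `|f j| <= b) ->
  ulim (fun j => - f j) = - ulim f.
Proof. by move=> /ulim_cvg fl; apply/cvg_lim => //; exact: cvgN. Qed.

Lemma scons_upi (n : nat) (x : nat -> M) (e : 'I_n -> nat -> M) :
  scons (upi x) (fun i => upi (e i)) = (fun i => upi (scons x e i)).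
Proof. by apply/funext => i; rewrite /scons; case: unlift. Qed.

Lemma scons_at (n : nat) (x : nat -> M) (e : 'I_n -> nat -> M) j :
  (fun i => scons x e i j) = scons (x j) (e^~ j).
Proof. by apply/funext => i; rewrite /scons; case: unlift. Qed.

Lemma eval_scons_upi (C : Type) (c : C -> nat -> M) n (psi : formula L C n.+1) :
  (forall e, eval (N := ultrapower) (fun a => upi (c a)) psi
    (fun i => upi (e i)) = ulim (fun j => eval (c^~ j) psi (e^~ j))) ->
  forall (e : 'I_n -> nat -> M) x,
  eval (N := ultrapower) (fun a => upi (c a)) psi
    (scons (upi x) (fun i => upi (e i))) =
  ulim (fun j => eval (c^~ j) psi (scons (x j) (e^~ j))).
Proof.
move=> IH e x; rewrite scons_upi IH; congr ulim; apply/funext => j.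
by rewrite scons_at.
Qed.

(** Łoś's theorem for real-valued formulas. A connective commutes with ultralimits by continuity,
    and an infimum is treated as the negative of a supremum. *)
Lemma eval_ultrapower (C : Type) (c : C -> nat -> M) n
    (phi : formula L C n) (e : 'I_n -> nat -> M) :
  eval (N := ultrapower) (fun a => upi (c a)) phi (fun i => upi (e i)) =
  ulim (fun j => eval (c^~ j) phi (e^~ j)).
Proof.
elim: phi e => {n} [n u v|n P us|n k u cu phis IH|n psi IH|n psi IH] e /=.
- by rewrite !teval_ultrapower; exact: mdist_upi.
- rewrite (funext (fun i => teval_ultrapower c e (us i))).
  have xb j := pinterp_norm (fun i => teval (c^~ j) (e^~ j) (us i)).
  apply/eqP; rewrite -subr_eq0 -normr_le0; apply/ler_addgt0Pl => d d0.
  rewrite addr0; apply: ulim_dist => [j|//|]; first exact: pinterp_norm.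
  set x := fun i j => teval (c^~ j) (e^~ j) (us i).
  apply: filterS (urep_near x (pmodulus_gt0 P d0)) => j.
  exact: pinterp_uc.
- have [b hb] := eval_bounded M (Fconn cu phis).
  symmetry; apply/cvg_lim => //.
  apply: (@cvg_comp _ _ _ (fun j => \row_i eval (c^~ j) (phis i) (e^~ j)) u);
    last exact: cu.
  apply/cvg_ballP => d d0.
  have : \forall j \near nat_ultra, forall i,
      `|eval (N := ultrapower) (fun a => upi (c a)) (phis i) (fun i => upi (e i)) -
        eval (c^~ j) (phis i) (e^~ j)| < d.
    apply: filter_forall => i; rewrite IH.
    have [b' hb'] := eval_bounded M (phis i).
    by have /cvgrPdist_lt := ulim_cvg (fun j => hb' (c^~ j) (e^~ j)); exact.
  by apply: filterS => j hj; split=> // i' i; rewrite !mxE; exact: hj.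
- have psiE := eval_scons_upi IH e; have [b hb] := eval_bounded M psi.
  rewrite -(@ulim_sup (fun j x => eval (c^~ j) psi (scons x (e^~ j))) b) //.
    by congr sup; apply: eq_imagel => p _; rewrite -psiE urepK.
  by move=> x; rewrite -!psiE urepK.
- have psiE := eval_scons_upi IH e; have [b hb] := eval_bounded M psi.
  have sb j : `|sup (range (fun x => - eval (c^~ j) psi (scons x (e^~ j))))| <= b.
    by apply: sup_range_norm => [|x]; rewrite ?normrN//; exact: carrier_inhabited.
  rewrite inf_rangeE; rewrite (funext (fun j => inf_rangeE _)) (ulimN sb).
  rewrite -(@ulim_sup (fun j x => - eval (c^~ j) psi (scons x (e^~ j))) b).
  + congr (- sup _); apply: eq_imagel => p _.
    by rewrite (ulimN (fun j => hb _ _)) -psiE urepK.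
  + by move=> j x; rewrite normrN.
  + by move=> x; rewrite !(ulimN (fun j => hb _ _)) -!psiE urepK.
Qed.

End UltrapowerStructure.

(** * Compactness and separated sequences *)

Lemma compactI_ext (T : topologicalType) (S P Q : set T) :
  (forall x, P x <-> Q x) -> compact (S `&` P) -> compact (S `&` Q).
Proof. by move=> PQ; rewrite (_ : P = Q)//; apply/seteqP; split=> x /PQ. Qed.

Lemma ultra_bigcup_seq (T : Type) (I : eqType) (F : set_system T) (s : seq I)
    (B : I -> set T) : UltraFilter F -> F (\bigcup_(i in [set` s]) B i) ->
  exists2 i, i \in s & F (B i).
Proof.
move=> FU; elim: s => [|a s IH] h.
  by move: h; rewrite set_nil bigcup_set0 => /filter_not_empty.
have [Fa|Fna] := in_ultra_setVsetC (B a) FU; first by exists a; rewrite ?mem_head.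
have [|i si Fi] := IH; last by exists i; rewrite // inE si orbT.
apply: filterS (filterI h Fna) => y [[i si Bi] nBa].
by move: si nBa; rewrite /= inE => /orP[/eqP <-|si nBa]; [|exists i].
Qed.

Section Separated.
Context (R : realType) (T : metricType R) (n : nat).
Implicit Types (S : set 'rV[T]_n) (e : R).

Lemma ball_rowP (x y : 'rV[T]_n) e : 0 < e ->
  ball x e y <-> forall i, mdist (x ord0 i) (y ord0 i) < e.
Proof.
move=> e0; split=> [[_ h] i|h]; first by have := h ord0 i; rewrite ballEmdist.
by split=> // i j; rewrite !ord1 ballEmdist /=; exact: h.
Qed.

Definition separated_seq S e (x : nat -> 'rV[T]_n) :=
  (forall i, S (x i)) /\ forall i j, (i < j)%N -> ~ ball (x i) e (x j).

(** Greedy choice: without a finite net, every finite list in [S] misses a ball-free point of [S],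
    and adding such points one at a time yields a separated sequence. *)
Lemma finite_net S e : ~ (exists x, separated_seq S e x) ->
  exists s : seq 'rV[T]_n, (forall x, x \in s -> S x) /\
    forall y, S y -> exists2 x, x \in s & ball x e y.
Proof.
move=> nosep; apply: contrapT => nonet; apply: nosep.
have [s0|Sne] := pselect (S = set0).
  by exfalso; apply: nonet; exists [::]; split=> // y; rewrite s0.
have [p0 Sp0] : S !=set0 by apply/set0P/eqP.
(* [g] is constrained only on lists contained in [S]; on the others [p0] is a dummy value. *)
have /choice[g hg] (s : seq 'rV[T]_n) : exists y, (forall x, x \in s -> S x) ->
    S y /\ forall x, x \in s -> ~ ball x e y.
  have [sS|nsS] := pselect (forall x, x \in s -> S x); last by exists p0.
  apply: contrapT => h; apply: nonet; exists s; split=> // y Sy.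
  apply: contrapT => h2; apply: h; exists y => _; split=> // x xs bx.
  by apply: h2; exists x.
pose ss := fix ss k := if k is k'.+1 then g (ss k') :: ss k' else [::].
have ssS k : forall x, x \in ss k -> S x.
  elim: k => // k IH x; rewrite inE => /orP[/eqP ->|/IH//].
  by have [] := hg _ IH.
have mem_ss i j : (i < j)%N -> g (ss i) \in ss j.
  elim: j => // j IH; rewrite ltnS leq_eqVlt inE => /orP[/eqP ->|/IH ->].
    by rewrite eqxx.
  by rewrite orbT.
exists (fun k => g (ss k)); split=> [i|i j ij]; first by have [] := hg _ (ssS i).
by have [_] := hg _ (ssS j); apply; exact: mem_ss.
Qed.

Lemma compact_not_separated S e : 0 < e -> compact S ->
  ~ exists x, separated_seq S e x.
Proof.
move=> e0 cS [x [Sx sep]].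
have xS : (x @ \oo) S by exists 0%N => // j _; exact: Sx.
have [p [_ clp]] := cS (x @ \oo) _ xS.
have e2 : 0 < e / 2 by lra.
have hit k : exists2 j, (k <= j)%N & ball p (e / 2) (x j).
  have xk : (x @ \oo) (x @` [set j | (k <= j)%N]).
    by exists k => // j kj; exists j.
  have [_ [[j kj <-] bj]] := clp _ _ xk (nbhsx_ballx p _ e2).
  by exists j.
have [i _ bi] := hit 0%N; have [j ij bj] := hit i.+1.
apply: (sep i j ij); rewrite (splitr e).
exact: ball_triangle (ball_sym bi) bj.
Qed.

(** One point more than the size of an [e / 2]-net forces two points into the same ball. The number
    [m] turns compactness into a statement about finitely many distances, which can be compared
    between models. *)
Lemma compact_pigeonhole S e : 0 < e -> compact S ->
  exists m, forall x : 'I_m -> 'rV[T]_n, (forall i, S (x i)) ->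
    exists i j, i != j /\ ball (x i) e (x j).
Proof.
move=> e0 cS; have e2 : 0 < e / 2 by lra.
have [s [_ hs]] := finite_net (compact_not_separated e2 cS).
exists (size s).+1 => x Sx.
have /choice[f hf] i : exists k : 'I_(size s),
    ball (tnth (in_tuple s) k) (e / 2) (x i).
  have [y ys by_] := hs _ (Sx i).
  have ks : (index y s < size s)%N by rewrite index_mem.
  by exists (Ordinal ks); rewrite (tnth_nth y) /= nth_index.
have /injectivePn[i [j ij fij]] : ~~ injectiveb f.
  apply/negP => /injectiveP /leq_card; rewrite !card_ord.
  by rewrite ltnn.
exists i, j; split=> //; rewrite (splitr e).
by apply: ball_triangle (ball_sym (hf i)) _; rewrite fij; exact: hf.
Qed.

(** Finite nets put a ball of every radius into an ultrafilter, which is therefore Cauchy in each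
    coordinate; the limits of the coordinates form the limit row. *)
Lemma compact_of_not_separated S :
  (forall F : set_system T, ProperFilter F -> cauchy F -> exists x : T, F --> x) ->
  closed S -> (forall e, 0 < e -> ~ exists x, separated_seq S e x) -> compact S.
Proof.
move=> complete clS nosep; rewrite compact_ultra.
suff main (F : set_system 'rV[T]_n) : UltraFilter F -> F S ->
    exists2 p, S p & F --> p by move=> F /main h /h[p]; exists p.
move=> FU FS.
have small_ball e : 0 < e -> exists x, F (ball x e).
  move=> e0; have [s [_ hs]] := finite_net (nosep _ e0).
  have : F (\bigcup_(x in [set` s]) ball x e).
    by apply: filterS FS => y /hs[x]; exists x.
  by move=> /(ultra_bigcup_seq FU)[x _ Fx]; exists x.
have /choice[l hl] (i : 'I_n) : exists l : T,
    (fun v : 'rV[T]_n => v ord0 i) @ F --> l.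
  apply: complete; apply: cauchy_exP => e e0.
  have [x Fx] := small_ball e e0; exists (x ord0 i).
  have : F [set v : 'rV[T]_n | ball (x ord0 i) e (v ord0 i)].
    by apply: filterS Fx => y /(ball_rowP _ _ e0) h; rewrite ballEmdist; exact: h.
  by [].
have Fl : F --> (\row_i l i : 'rV[T]_n).
  apply/cvg_ballP => e e0.
  have : \forall v \near F, forall i : 'I_n, ball (l i) e ((v : 'rV[T]_n) ord0 i).
    by apply: filter_forall => i; have /cvg_ballP := hl i; exact.
  by apply: filterS => v hv; split=> // i j; rewrite ord1 mxE; exact: hv.
exists (\row_i l i) => //.
exact: (@closed_cvg _ _ F _ id S clS FS).
Qed.

End Separated.

(** * Small sets of parameters *)

Section Small.
Local Open Scope card_scope.

Lemma card_leTP (K T : Type) (A : set T) :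
  [set: K] #<= A <-> exists2 f : K -> T, injective f & forall k, A (f k).
Proof.
split=> [/card_leP[f]|[f fi fA]].
  pose in_setT (k : K) : [set: K] := SigSub (mem_set (I : [set: K] k)).
  exists (fun k => set_val (f (in_setT k))) => [x y /val_inj fxy|k].
    have /(congr1 set_val) : in_setT x = in_setT y.
      by apply: (@inj _ _ _ f); rewrite ?inE.
    by [].
  exact: set_valP.
have := @inj_card_eq _ _ [set: K] f (in2W fi).
move=> /card_eqPle[_ /card_le_trans]; apply; apply: subset_card_le.
by move=> _ [k _ <-].
Qed.

(** Hilbert's hotel: [K] is infinite, as it does not inject into [nat], so an injection into [A]
    with [x] added that takes the value [x] at [k0] can be precomposed with an injection of [K] into
    itself avoiding [k0]. *)
Lemma small_setU1 (K T : Type) (A : set T) (x : T) :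
  small K [set: nat] -> small K A -> small K (A `|` [set x]).
Proof.
move=> Knat KA /card_leTP[f fi fA]; apply: KA; apply/card_leTP.
have [[k0 fk0]|nx] := pselect (exists k, f k = x); last first.
  by exists f => // k; case: (fA k) => // fk; case: nx; exists k.
have /infiniteP/card_leTP[s si _] : infinite_set [set: K].
  by move=> /finite_set_countable.
(* [h] shifts the sequence [s] by one place and so misses [s 0]; the permutation [t] below swaps
   [s 0] and [k0], so that [t \o h] misses [k0]. *)
pose h k := if pselect (exists i, s i = k) is left p then s (sval (cid p)).+1 else k.
have hs i : h (s i) = s i.+1.
  rewrite /h; case: pselect => [p|[]]; last by exists i.
  by case: cid => j /= /si ->.
have hn k : ~ (exists i, s i = k) -> h k = k by rewrite /h; case: pselect.
have hi : injective h.
  move=> k k'; have [[i <-]|nk] := pselect (exists i, s i = k);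
    have [[i' <-]|nk'] := pselect (exists i, s i = k');
    rewrite ?hs ?(hn _ nk) ?(hn _ nk').
  - by move=> /si[->].
  - by move=> ek; case: nk'; rewrite -ek; exists i.+1.
  - by move=> ek; case: nk; rewrite ek; exists i'.+1.
  - by [].
have h0 k : h k <> s 0%N.
  have [[i <-]|nk] := pselect (exists i, s i = k); first by rewrite hs => /si.
  by rewrite (hn _ nk) => ek; case: nk; exists 0%N.
pose t k := if pselect (k = k0) then s 0%N else
            if pselect (k = s 0%N) then k0 else k.
have ti : injective t.
  move=> k k'; rewrite /t.
  by repeat (case: pselect => ? /=); move=> *; congruence.
have t0 k : t k = k0 -> k = s 0%N.
  by rewrite /t; repeat (case: pselect => ? /=); move=> *; congruence.
exists (f \o t \o h) => [|k]; first by do 2! apply: inj_comp => //.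
case: (fA (t (h k))) => // e; exfalso; apply: (h0 k); apply: t0; apply: fi.
by rewrite fk0.
Qed.

Lemma small_setU (K T : Type) (A F : set T) :
  small K [set: nat] -> small K A -> finite_set F -> small K (A `|` F).
Proof.
move=> Knat KA; move=> /finite_setP[m]; elim: m F => [|m IH] F.
  by rewrite II0 card_eq0 => /eqP ->; rewrite setU0.
move=> /eq_cardSP[x Fx /IH KF].
rewrite -(setD1K Fx) setUA (setUC A) -setUA setUC; exact: small_setU1.
Qed.

End Small.

(** * Saturation and homogeneity *)

Notation embm N := (@emb _ _ _ _ N).

Lemma row_ord0 (T : Type) n (e : 'I_n -> T) : (\row_i e i) ord0 = e :> ('I_n -> T).
Proof. by apply/funext => i; rewrite mxE. Qed.

Section Realization.
Context (R : realType) (L : signature R) (M : mstructure L).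

Fixpoint finfs (C : Type) k : formula L C k -> formula L C 0 :=
  match k return formula L C k -> formula L C 0 with
  | 0 => id
  | k'.+1 => fun psi => finfs (Finf psi)
  end.

Lemma no_varE (T : Type) (e : 'I_0 -> T) : e = @no_var T.
Proof. by apply/funext => -[]. Qed.

Lemma scons_eta (T : Type) k (e : 'I_k.+1 -> T) :
  scons (e ord0) (fun i => e (lift ord0 i)) = e.
Proof. by apply/funext => i; rewrite /scons; case: unliftP => [j|] ->. Qed.

Lemma eval_finf_le (N : mstructure L) (C : Type) (c : C -> N) k
    (psi : formula L C k.+1) e x : eval c (Finf psi) e <= eval c psi (scons x e).
Proof.
have [b hb] := eval_bounded N psi.
rewrite /= inf_rangeE lerNl.
apply: (@sup_range_ub _ _ (fun x => - eval c psi (scons x e)) b) => y.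
by rewrite normrN.
Qed.

Lemma eval_finf_lt (N : mstructure L) (C : Type) (c : C -> N) k
    (psi : formula L C k.+1) e t : eval c (Finf psi) e < t ->
  exists x, eval c psi (scons x e) < t.
Proof.
move=> h; apply: contrapT => nx.
suff : t <= eval c (Finf psi) e by rewrite leNgt h.
rewrite /= inf_rangeE lerNr; apply: sup_range_le => [|x].
  exact: carrier_inhabited.
by rewrite lerN2 leNgt; apply/negP => ht; apply: nx; exists x.
Qed.

Lemma eval_finfs_le (N : mstructure L) (C : Type) (c : C -> N) k
    (psi : formula L C k) e : eval c (finfs psi) (@no_var N) <= eval c psi e.
Proof.
elim: k psi e => [|k IH] psi e /=; first by rewrite (no_varE e).
rewrite -(scons_eta e); apply: le_trans (IH _ _) _; exact: eval_finf_le.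
Qed.

Lemma eval_finfs_lt (N : mstructure L) (C : Type) (c : C -> N) k
    (psi : formula L C k) t : eval c (finfs psi) (@no_var N) < t ->
  exists e, eval c psi e < t.
Proof.
elim: k psi => [|k IH] psi /=; first by exists (@no_var N).
by move=> /IH[e /eval_finf_lt[x hx]]; exists (scons x e).
Qed.

Lemma normB_continuous m (r : 'rV[R]_m) : continuous (fun v : 'rV[R]_m => `|v - r|).
Proof.
move=> v; apply: continuous_comp; last exact: norm_continuous.
by apply: continuousB; [move=> ?|exact: cst_continuous].
Qed.

Lemma norm_row_lt m (v w : 'rV[R]_m) e : `|v - w| < e ->
  forall i, `|v ord0 i - w ord0 i| < e.
Proof.
by move=> vw i; have : ball v e w; [rewrite -ball_normE|case=> _ /(_ ord0 i)].
Qed.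

(** The sentence stating the infimum of the distance between the values of [phi] and [r] has the
    same value in [N] and in [M]. It is at most 0 in [N], but an infimum need not be attained in
    [M], whence the error [e]. *)
Lemma approx_realization (B : set M) (N : model_over B) k (b : 'rV[N]_k) m
    (phi : 'I_m -> formula L B k) (e : R) : 0 < e ->
  exists b' : 'rV[M]_k, forall i,
    `|eval set_val (phi i) (b' ord0) - eval (embm N) (phi i) (b ord0)| < e.
Proof.
move=> e0; pose r : 'rV[R]_m := \row_i eval (embm N) (phi i) (b ord0).
pose psi := Fconn (@normB_continuous _ r) phi.
have psi0 : eval (embm N) psi (b ord0) = 0 by rewrite /= subrr normr0.
have : eval set_val (finfs psi) (@no_var M) < e.
  rewrite -(@emb_elementary _ _ _ _ N (finfs psi)).
  by apply: le_lt_trans (eval_finfs_le _ _ (b ord0)) _; rewrite psi0.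
move=> /eval_finfs_lt[e' /= /norm_row_lt h].
exists (\row_i e' i) => i; have := h i; by rewrite !mxE row_ord0.
Qed.

(** This is twice the positive part of [|v - r| - e]. Saturation handles conditions of the form
    [phi = 0] only, and this connective brings an inequality into that form. *)
Lemma excess_continuous (r e : R) :
  continuous (fun v : 'rV[R]_1 =>
    `|v ord0 ord0 - r| - e + `| `|v ord0 ord0 - r| - e |).
Proof.
move=> v; have h0 := @coord_continuous R 1 1 ord0 ord0 v.
have h1 := continuousB h0 (@cst_continuous _ _ r v).
have h2 := continuous_comp h1 (@norm_continuous _ _ _).
have h3 := continuousB h2 (@cst_continuous _ _ e v).
exact: (continuousD h3 (continuous_comp h3 (@norm_continuous _ _ _))).
Qed.

Definition fclose (C : Type) k (phi : formula L C k) (r e : R) : formula L C k :=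
  Fconn (@excess_continuous r e) (fun=> phi).

Lemma eval_fclose (N : mstructure L) (C : Type) (c : C -> N) k
    (phi : formula L C k) r e v :
  eval c (fclose phi r e) v = 0 <-> `|eval c phi v - r| <= e.
Proof.
rewrite /= mxE -subr_le0; set x := _ - e; split=> [h|h].
  by have := normr_ge0 x; lra.
by rewrite (ler0_norm h) subrr.
Qed.

Context (K : Type) (satM : saturated K M).

(** The conditions that [phi] lies within [e] of [r phi], for all [phi] and all [e > 0], are
    finitely satisfiable, and together they force exact values. The map [r] is not assumed to come
    from a type, which allows limits of types. *)
Lemma saturated_values (B : set M) k (r : formula L B k -> R) : small K B ->
  (forall m (phi : 'I_m -> formula L B k) e, 0 < e -> exists b : 'rV[M]_k,
    forall i, `|eval set_val (phi i) (b ord0) - r (phi i)| < e) ->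
  exists b : 'rV[M]_k, forall phi, eval set_val phi (b ord0) = r phi.
Proof.
move=> sB approx.
pose G : set (formula L B k) := [set psi | exists phi e, 0 < e /\
  psi = fclose phi (r phi) e].
have [G0 G0G fG0|b' hb'] := satM sB (G := G).
  have [s sG0] : exists s : seq (formula L B k), G0 = [set` s] by exact/finite_seqP.
  have /choice[phi /choice[e he]] (i : 'I_(size s)) : exists phi e, 0 < e /\
      tnth (in_tuple s) i = fclose phi (r phi) e.
    by apply: G0G; rewrite sG0 /=; exact: mem_tnth.
  have [||d d0 hd] := @fin_pos R _ (fun i d => d <= e i).
  - by move=> i d d' h _ /le_trans; exact.
  - by move=> i; exists (e i) => //; case: (he i).
  have [b' hb'] := approx _ phi d d0.
  exists b' => psi; rewrite sG0 /= => /(@tnthP _ _ (in_tuple s))[i ->].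
  by rewrite (he i).2; apply/eval_fclose/ltW; apply: lt_le_trans (hb' i) (hd i).
exists b' => phi; apply/eqP; rewrite -subr_eq0 -normr_le0.
apply/ler_addgt0Pl => e e0; rewrite addr0; apply/eval_fclose.
by apply: hb'; exists phi, e.
Qed.

Lemma realize_tuple (B : set M) (N : model_over B) k (b : 'rV[N]_k) :
  small K B -> exists b' : 'rV[M]_k, forall phi : formula L B k,
    eval set_val phi (b' ord0) = eval (embm N) phi (b ord0).
Proof.
by move=> sB; apply: saturated_values => // m phi e; exact: approx_realization.
Qed.

(** The tuples are concatenated into one of length [m * n], so that a single realization respects
    their types and also their mutual distances. *)
Lemma realize_family (B : set M) (N : model_over B) m n (b : 'I_m -> 'rV[N]_n) :
  small K B -> exists b' : 'I_m -> 'rV[M]_n,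
    (forall i (phi : formula L B n),
      eval set_val phi (b' i ord0) = eval (embm N) phi (b i ord0)) /\
    forall i j k l, mdist (b' i ord0 k) (b' j ord0 l) =
      mdist (b i ord0 k) (b j ord0 l).
Proof.
move=> sB; pose v : 'rV[N]_(m * n) := mxvec (\matrix_(i, k) b i ord0 k).
have [v' hv'] := realize_tuple v sB.
have vE i k : v ord0 (mxvec_index i k) = b i ord0 k by rewrite mxvecE mxE.
exists (fun i => \row_k v' ord0 (mxvec_index i k)); split=> [i phi|i j k l].
  have := hv' (fsubst phi (fun k => Var L B (mxvec_index i k)) (fun a => Par L _ a)).
  rewrite !eval_fsubst /= => h.
  by rewrite row_ord0 h; congr (eval _ _ _); apply/funext => k.
have := hv' (Fdist (Var L B (mxvec_index i k)) (Var L B (mxvec_index j l))).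
by rewrite /= !mxE !vE.
Qed.

End Realization.

(** * Type spaces *)

Section Types.
Context (R : realType) (L : signature R) (M : mstructure L) (B : set M) (n : nat).

Lemma tp_eqP (N N' : model_over B) (b : 'rV[N]_n) (b' : 'rV[N']_n) :
  tp b = tp b' <-> forall phi : formula L B n,
    eval (embm N) phi (b ord0) = eval (embm N') phi (b' ord0).
Proof.
split=> [/(congr1 set_val) /= h phi|h].
  by have := congr1 (fun p : formula L B n -> R => p phi) h.
by apply: val_inj; apply/funext => phi; exact: h.
Qed.

Lemma stype_tp (p : stype B n) :
  exists (N : model_over B) (b : 'rV[N]_n), p = tp b.
Proof.
have [N [b pb]] := set_valP p; exists N, b.
by apply: val_inj.
Qed.

Lemma stype_eval_continuous (phi : formula L B n) :
  continuous (fun p : stype B n => set_val p phi).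
Proof.
move=> p.
have h : set_val @ p --> (set_val p : {ptws formula L B n -> R}).
  exact: (@initial_continuous (stype B n) {ptws formula L B n -> R} set_val p).
exact: cvg_comp h (@proj_continuous (formula L B n) (fun=> R) phi _).
Qed.

Lemma stype_cvgP (F : set_system (stype B n)) (p : stype B n) : Filter F ->
  (forall phi, (fun q : stype B n => set_val q phi) @ F --> set_val p phi) ->
  F --> p.
Proof.
move=> FF h.
have {}h : set_val @ F --> (set_val p : {ptws formula L B n -> R}).
  apply/cvg_sup => phi; apply/cvg_image.
    by rewrite eqEsubset; split=> // r _; exists (fun=> r).
  move=> A /h FA; exists ((fun f : formula L B n -> R => f phi) @^-1` A) => //.
  by rewrite eqEsubset; split=> [_ [f Af <-]//|r Ar]; exists (fun=> r).
move=> A [_ [[U oU <-] pU] /= UA].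
have : (set_val @ F) U by apply: h; exact: open_nbhs_nbhs.
by move=> FU; exact: (filterS UA FU).
Qed.

Lemma eval_continuous (N : model_over B) (phi : formula L B n) :
  continuous (fun b : 'rV[N]_n => eval (embm N) phi (b ord0)).
Proof.
move=> b U /nbhs_ballP[e /= e0 eU]; have e2 : 0 < e / 2 by lra.
have [d d0 hd] := eval_unif_continuous (embm N) phi e2.
apply/nbhs_ballP; exists d => //= b' /(ball_rowP _ _ d0) bb'.
by apply: eU; apply: le_lt_trans (hd _ _ bb') _; lra.
Qed.

Lemma tp_continuous (N : model_over B) :
  continuous (fun b : 'rV[N]_n => tp b : stype B n).
Proof.
move=> b; have FF := @nbhs_pfilter 'rV[N]_n b.
apply: (@stype_cvgP _ _ (fmap_filter _ _)) => phi; exact: eval_continuous.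
Qed.

Lemma closed_realizations (N : model_over B) (F : set (stype B n)) :
  closed F -> closed (realizations N F).
Proof. by move=> cF; apply: preimage_closed cF => x _; exact: tp_continuous. Qed.

Lemma stype_hausdorff : hausdorff_space (stype B n).
Proof.
move=> p q pq; apply: val_inj; apply/funext => phi.
apply: (@Rhausdorff R) => U V Up Vq.
have [r [Ur Vr]] := pq _ _ (stype_eval_continuous Up) (stype_eval_continuous Vq).
by exists (set_val r phi).
Qed.

End Types.

(** * Automorphisms of the monster model *)

Section Automorphisms.
Context (R : realType) (L : signature R) (M : mstructure L).

Lemma automorphism_teval (g : M -> M) (C : Type) (c : C -> M) n (e : 'I_n -> M)
    (t : term L C n) : automorphism g ->
  g (teval c e t) = teval (g \o c) (g \o e) t.
Proof.
move=> [_ _ gf _]; elim: t => //= f us IH; rewrite gf; congr finterp.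
by apply/funext => i.
Qed.

Lemma scons_comp (T T' : Type) (g : T -> T') n x (e : 'I_n -> T) :
  g \o scons x e = scons (g x) (g \o e).
Proof. by apply/funext => i; rewrite /scons /=; case: unlift. Qed.

Lemma range_bij (S T : Type) (g : S -> S) (f : S -> T) : bijective g ->
  range (f \o g) = range f.
Proof.
move=> [g' _ g'K]; apply/seteqP; split=> [_ [x _ <-]|_ [x _ <-]].
  by exists (g x).
by exists (g' x) => //=; rewrite g'K.
Qed.

Lemma automorphism_eval (g : M -> M) (C : Type) (c : C -> M) n
    (phi : formula L C n) (e : 'I_n -> M) : automorphism g ->
  eval (g \o c) phi (g \o e) = eval c phi e.
Proof.
move=> ag; have [bg gd gf gP] := ag.
elim: phi e => {n} [n u v|n P us|n k u cu phis IH|n psi IH|n psi IH] e /=.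
- by rewrite -!automorphism_teval // gd.
- rewrite -[RHS]gP; congr pinterp; apply/funext => i; exact/esym/automorphism_teval.
- by congr u; apply/rowP => i; rewrite !mxE.
- rewrite -(range_bij _ bg); congr sup; apply: eq_imagel => x _ /=.
  by rewrite -scons_comp.
- rewrite -(range_bij _ bg); congr inf; apply: eq_imagel => x _ /=.
  by rewrite -scons_comp.
Qed.

Definition fixes (g : M -> M) (B : set M) := forall b, B b -> g b = b.

Lemma fixes_eval (g : M -> M) (B : set M) n (phi : formula L B n) (e : 'I_n -> M) :
  automorphism g -> fixes g B ->
  eval set_val phi (g \o e) = eval set_val phi e.
Proof.
move=> ag gB; rewrite -[RHS](automorphism_eval _ _ _ ag); congr (eval _ phi _).
by apply/funext => b /=; rewrite gB //; exact: set_valP.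
Qed.

Definition same_type (B : set M) n (x y : 'rV[M]_n) := forall phi : formula L B n,
  eval set_val phi (x ord0) = eval set_val phi (y ord0).

Lemma same_typeP (B : set M) n (x y : 'rV[M]_n) :
  tp (N := self_model B) x = tp (N := self_model B) y <-> same_type B x y.
Proof. exact: tp_eqP. Qed.

Lemma same_type_sym (B : set M) n (x y : 'rV[M]_n) :
  same_type B x y -> same_type B y x.
Proof. by move=> h phi; rewrite h. Qed.

Lemma same_type_sub (B C : set M) n (x y : 'rV[M]_n) : B `<=` C ->
  same_type C x y -> same_type B x y.
Proof. by move=> BC h phi; have := h (fmap (incl BC) phi); rewrite !eval_fmap. Qed.

Context (K : Type) (Knat : small K [set: nat]) (homM : strongly_homogeneous K M).

(** Homogeneity extends maps defined on a set, so each element of [B] or of the range of [x] is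
    written as a term [t c] in [x], a constant whenever possible, and sent to the value of that term
    at [y]. *)
Lemma homogeneous_tuple (B : set M) n (x y : 'rV[M]_n) : small K B ->
  same_type B x y -> exists g : M -> M,
    [/\ automorphism g, fixes g B & map_mx g x = y].
Proof.
move=> sB xy; pose C := B `|` range (x ord0).
have sC : small K C.
  by apply: small_setU => //; exact/finite_image/finite_finset.
have hC (c : C) : {b : B | set_val b = set_val c} +
    {i | x ord0 i = set_val c /\ ~ B (set_val c)}.
  have [Bc|nBc] := pselect (B (set_val c)).
    by left; exists (SigSub (mem_set Bc)).
  right; apply: cid; have [//|[i _ xi]] := set_valP c; by exists i.
pose t (c : C) : term L B n :=
  match hC c with inl b => Par L n (sval b) | inr i => Var L B (sval i) end.
have tx c : teval set_val (x ord0) (t c) = set_val c.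
  by rewrite /t; case: (hC _) => [[b]|[i []]].
pose f (c : C) := teval set_val (y ord0) (t c).
have [|g ag gf] := homM sC (f := f).
  move=> phi.
  have := xy (fsubst phi (fun i => Var L B (False_rect _ (notF (ltn_ord i)))) t).
  rewrite !eval_fsubst !(no_varE (fun=> _)) -/f => <-.
  by congr (eval _ phi _); apply/funext.
exists g; split=> // [b Bb|].
  have Cb : C b by left.
  pose c : C := SigSub (mem_set Cb); rewrite -[LHS]/(g (set_val c)) gf /f /t.
  by case: (hC c) => [[b' /= ->]|[i [_ []]]].
apply/rowP => i; rewrite mxE.
have Cx : C (x ord0 i) by right; exists i.
pose c : C := SigSub (mem_set Cx); rewrite -[LHS]/(g (set_val c)) gf /f.
(* [t c] may differ from the variable [i], if the coordinate lies in [B] or is repeated; but the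
   distance of the two terms vanishes at [x], hence at [y]. *)
have := xy (Fdist (t c) (Var L B i)); rewrite /= tx mdistxx.
by move=> /esym /mdist_positivity.
Qed.

End Automorphisms.

(** * Restriction of models, and the ultrapower as a model over a set *)

Section Models.
Context (R : realType) (L : signature R) (M : mstructure L).

Lemma restrict_elementary (B C : set M) (BC : B `<=` C) (N : model_over C) :
  elementary (embm N \o incl BC).
Proof.
move=> phi; rewrite -(eval_fmap _ (incl BC)) (@emb_elementary _ _ _ _ N).
by rewrite eval_fmap.
Qed.

Definition restrict_model (B C : set M) (BC : B `<=` C) (N : model_over C) :
    model_over B := ModelOver (restrict_elementary BC N).

Lemma ulim_cst (r : R) : ulim (fun=> r) = r.
Proof. by apply/cvg_lim => //; exact: cvg_cst. Qed.

Lemma ultrapower_elementary (B : set M) :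
  elementary (N := ultrapower M) (fun b : B => upi (fun=> set_val b)).
Proof.
move=> phi; rewrite -(no_varE (fun i : 'I_0 => upi (fun=> @no_var M i))).
rewrite (eval_ultrapower (fun b _ => set_val b) _ (fun i _ => @no_var M i)).
exact: ulim_cst.
Qed.

Definition ultrapower_over (B : set M) : model_over B :=
  ModelOver (@ultrapower_elementary B).

Definition urow n (d : nat -> 'rV[M]_n) : 'rV[ultrapower M]_n :=
  \row_i upi (fun j => d j ord0 i).

Lemma eval_urow (B : set M) n (d : nat -> 'rV[M]_n) (phi : formula L B n) :
  eval (embm (ultrapower_over B)) phi (urow d ord0) =
  ulim (fun j => eval set_val phi (d j ord0)).
Proof. by rewrite /urow row_ord0 /= eval_ultrapower. Qed.

End Models.

(** * Algebraicity tested in the monster model *)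

Section Algebraicity.
Context (R : realType) (L : signature R) (M : mstructure L).

Lemma closed_tp (B : set M) n (p : stype B n) : closed [set p].
Proof.
by apply: accessible_closed_set1; exact/hausdorff_accessible/stype_hausdorff.
Qed.

(** If some model had a separated sequence in [F], then [m] of its terms, with their types and
    distances, would be copied into [M] against the pigeonhole bound. *)
Lemma algebraic_of_compact (K : Type) (B : set M) n (F : set (stype B n)) :
  saturated K M -> small K B -> closed F ->
  compact (realizations (self_model B) F) -> algebraic F.
Proof.
move=> satM sB cF cptF N; apply: compact_of_not_separated.
- exact: (@carrier_complete _ _ N).
- exact: closed_realizations.
- move=> e e0 [x [Fx sep]].
  have [m hm] := compact_pigeonhole e0 cptF.
  have [y [ty dy]] := realize_family satM (fun i : 'I_m => x i) sB.
  have [i|i [j [ij bij]]] := hm y.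
    have h : tp (N := self_model B) (y i) = tp (N := N) (x i).
      by apply/tp_eqP => phi; exact: ty.
    by rewrite /realizations /= h; exact: Fx.
  have bx : ball (x i) e (x j).
    by apply/ball_rowP => // k; rewrite -dy; exact: (proj1 (ball_rowP _ _ e0) bij).
  have : (i < j)%N || (j < i)%N by rewrite -neq_ltn.
  by case/orP => [/sep|/sep]; [exact|apply; exact: ball_sym].
Qed.

Lemma acl_mono (B C : set M) n (b : 'rV[M]_n) : B `<=` C -> acl B b -> acl C b.
Proof.
move=> BC aB N; apply: (subclosed_compact _ (aB (restrict_model BC N))).
  apply: (@closed_realizations _ _ _ C n N); exact: closed_tp.
move=> c /tp_eqP h.
apply/(@tp_eqP _ _ _ B _ (restrict_model BC N) (self_model B)) => phi.
by have := h (fmap (incl BC) phi); rewrite !eval_fmap.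
Qed.

End Algebraicity.

Lemma minr_dist (R : realDomainType) (a b c : R) :
  `|Num.min a c - Num.min b c| <= `|a - b|.
Proof.
have := ler_norm (a - b); have := ler_norm (b - a); rewrite (distrC b a).
rewrite !minEle ler_norml.
by case: ifP => c1; case: ifP => c2 *; apply/andP; split; lra.
Qed.

Lemma minr_dist_le (R : realDomainType) (a b c : R) : 0 <= a -> 0 <= b ->
  0 <= c -> `|Num.min a c - Num.min b c| <= c.
Proof.
move=> a0 b0 c0; rewrite !minEle ler_norml.
by case: ifP => c1; case: ifP => c2; apply/andP; split; lra.
Qed.

(** * Compactness of the type space, and definable sets as zerosets *)

Section TypeSpaceCompact.
Context (R : realType) (L : signature R) (M : mstructure L) (K : Type).
Context (satM : saturated K M) (B : set M) (sB : small K B) (n : nat).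

Lemma stype_realized (p : stype B n) :
  exists b : 'rV[M]_n, p = tp (N := self_model B) b.
Proof.
have [N [b ->]] := stype_tp p; have [b' hb'] := realize_tuple satM b sB.
by exists b'; apply/tp_eqP => phi; exact/esym.
Qed.

(** Along an ultrafilter of types the value of every formula has a limit; these limits are
    approximated by realized types, hence they are the values of a tuple of [M]. *)
Lemma stype_compact : compact [set: stype B n].
Proof.
rewrite compact_ultra.
suff main (F : set_system (stype B n)) : UltraFilter F ->
    exists p : stype B n, F --> p.
  by move=> F FU _; have [p Fp] := main F FU; exists p.
move=> FU.
have /choice[r hr] (phi : formula L B n) : exists l : R,
    (fun q : stype B n => set_val q phi) @ F --> l.
  have [b hb] := eval_bounded M phi; apply: (@ultra_bounded_cvg _ _ _ _ b) => p.
  by have [x ->] := stype_realized p; exact: hb.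
have [|b hb] := saturated_values satM (r := r) sB.
  move=> m phi e e0.
  pose P i := [set q : stype B n | `|set_val q (phi i) - r (phi i)| < e].
  have : F [set q | forall i, P i q].
    apply: (@filter_forall _ _ P F) => i.
    by have /cvgrPdistC_lt := hr (phi i); exact.
  move=> /filter_ex[q hq]; have [b qb] := stype_realized q.
  by exists b => i; have := hq i; rewrite qb.
exists (tp (N := self_model B) b); apply: stype_cvgP => phi.
by have -> : set_val (tp (N := self_model B) b) phi = r phi by exact: hb.
Qed.

Lemma set_dist_ltP (D : set (stype B n)) q (e : R) :
  (set_dist q D < e%:E)%E <-> exists a b : 'rV[M]_n,
    [/\ tp (N := self_model B) a = q, D (tp (N := self_model B) b) &
        tuple_dist a b < e].
Proof.
split=> [/ereal_inf_ltP[_ [p Dp <-] /ereal_inf_ltP[_ [a [b [ta tb ->]]] ab]]|].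
  by exists a, b; split=> //; rewrite tb.
move=> [a [b [ta Db ab]]]; apply/ereal_inf_ltP.
exists (type_dist q (tp (N := self_model B) b)).
  by exists (tp (N := self_model B) b).
by apply/ereal_inf_ltP; exists (tuple_dist a b)%:E => //; exists a, b.
Qed.

Lemma tuple_dist_ltP (a b : 'rV[M]_n) e : 0 < e ->
  tuple_dist a b < e <-> forall i, mdist (a ord0 i) (b ord0 i) < e.
Proof.
move=> e0; rewrite /tuple_dist; split=> [h i|h].
  apply: le_lt_trans h.
  exact: (le_bigmax _ (fun i => mdist (a ord0 i) (b ord0 i))).
by apply/bigmax_ltP.
Qed.

Let h k : R := 2^-1 ^+ k.

Let h_gt0 k : 0 < h k. Proof. by rewrite exprn_gt0// invr_gt0. Qed.

Let h_lt e : 0 < e -> exists k0, forall k, (k0 <= k)%N -> h k < e.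
Proof.
move=> e0; have [k0 _ hk] : \forall k \near \oo, h k < e.
  have /cvgr_lt : h @ \oo --> (0 : R).
    by apply: cvg_expr; rewrite ger0_norm; lra.
  exact.
by exists k0.
Qed.

(** Realizations [b k] of [D] get close to realizations of [q], and formulas are uniformly
    continuous, so the types of the [b k] converge to [q] in the logic topology. *)
Lemma closed_set_dist (D : set (stype B n)) q : closed D ->
  (forall k, set_dist q D < (h k)%:E)%E -> D q.
Proof.
move=> cD hq.
have /choice[b hb] k : exists b : 'rV[M]_n, exists a,
    [/\ tp (N := self_model B) a = q,
    D (tp (N := self_model B) b) & tuple_dist a b < h k].
  by have /set_dist_ltP[a [b ?]] := hq k; exists b, a.
have bq : (fun k => tp (N := self_model B) (b k)) @ \oo --> q.
  apply: stype_cvgP => phi; apply/cvgrPdist_le => e e0.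
  have [d d0 hd] := eval_unif_continuous (fun a : B => set_val a) phi e0.
  have [k0 hk] := h_lt d0; exists k0 => // k /= k0k.
  have [a [<- _ ab]] := hb k; apply: hd.
  by apply/tuple_dist_ltP => //; exact: lt_trans ab (hk _ k0k).
apply: (@closed_cvg _ _ _ _ (fun k => tp (N := self_model B) (b k)) D cD _ _ bq).
by exists 0%N => // k _; have [a []] := hb k.
Qed.

(** Urysohn functions [f k] vanish on [D] and equal 1 outside a neighbourhood contained in the
    metric [2^-k]-neighbourhood of [D]. A common zero is at distance zero from [D], hence in [D]. *)
Lemma zeroset_of_definable (D : set (stype B n)) : definable D -> zeroset D.
Proof.
move=> [cD defD].
have nT : normal_space (stype B n).
  by apply: compact_normal; [exact: stype_hausdorff|exact: stype_compact].
have /choice[f hf] k : exists f : stype B n -> R, [/\ continuous f,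
    forall q, 0 <= f q, forall q, D q -> f q = 0 &
    forall q, f q = 0 -> (set_dist q D < (h k)%:E)%E].
  have [U [oU DU Ud]] := defD _ (h_gt0 k).
  have DU0 : D `&` ~` U = set0 by apply/disjoints_subset; rewrite setCK.
  have := (@normal_separatorP R _).1 nT _ _ cD (open_closedC oU) DU0.
  move=> /(@uniform_separatorP _ R)[g [cg g01 gD gU]].
  exists g; split=> // [q|q Dq|q gq].
  - by have /andP[] : 0 <= g q <= 1 by have := g01 _ (imageT g q); rewrite /= in_itv.
  - by apply: gD; exists q.
  - apply: Ud; apply: contrapT => nUq.
    have : g q = 1 by apply: gU; exists q.
    by rewrite gq => /esym/eqP; rewrite oner_eq0.
(* Truncating at [h k] makes the supremum over [k] continuous: beyond some [k0] all terms are
   uniformly small, and finitely many continuous ones remain. *)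
pose g k q : R := Num.min (f k q) (h k).
have h1 k : h k <= 1 by apply: exprn_ile1; lra.
have g1 q k : `|g k q| <= 1.
  have [_ f0 _ _] := hf k; rewrite /g ger0_norm ?ge_min ?h1 ?orbT//.
  by rewrite le_min f0 ltW.
exists (fun q => sup (range (g^~ q))).
  move=> q U /nbhs_ballP[e /= e0 eU]; have {}e0 : 0 < e / 2 by lra.
  have FF := @nbhs_pfilter (stype B n) q.
  have [k0 hk] := h_lt e0.
  pose P (i : 'I_k0) := [set q' | `|f i q - f i q'| <= e / 2].
  have : nbhs q [set q' | forall i, P i q'].
    apply: (@filter_forall _ _ P (nbhs q)) => i; have [cf _ _ _] := hf i.
    by have /cvgrPdist_le := cf q; exact.
  apply: filterS => q' hq'; apply: eU; rewrite /ball /=.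
  apply: (@le_lt_trans _ _ (e / 2)); last by lra.
  apply: (@sup_range_dist _ _ _ _ 1) => //.
  move=> k; have [kk0|k0k] := ltnP k k0.
    by apply: le_trans (minr_dist _ _ _) _; exact: (hq' (Ordinal kk0)).
  have [_ f0 _ _] := hf k.
  apply: le_trans (minr_dist_le _ _ _) (ltW (hk _ k0k)) => //.
  exact: ltW.
apply/seteqP; split=> q /=.
  move=> Dq; have -> : g^~ q = fun=> 0.
    apply/funext => k; have [_ _ fD _] := hf k; rewrite /g fD//.
    by apply/min_idPl; exact: ltW.
  apply/eqP; rewrite eq_le; apply/andP; split.
    by apply: sup_range_le => //; exact: (inhabits 0%N).
  by apply: (@sup_range_ub _ _ _ 1 0%N) => k; rewrite normr0.
move=> s0; apply: closed_set_dist => // k; have [_ f0 _] := hf k; apply.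
have : g k q <= 0 by rewrite -s0; apply: (@sup_range_ub _ _ (g^~ q) 1) => k'.
rewrite /g ge_min [h k <= 0]leNgt h_gt0 orbF => fk.
by apply/eqP; rewrite eq_le fk f0.
Qed.

End TypeSpaceCompact.

(** * Restriction of types to fewer parameters *)

Section Restriction.
Context (R : realType) (L : signature R) (M : mstructure L).
Context (B C : set M) (BC : B `<=` C) (n : nat).

Lemma type_restrict_complete (p : stype C n) :
  (fun phi : formula L B n => set_val p (fmap (incl BC) phi)) \in
  [set q | exists (N : model_over B) (b : 'rV[N]_n), q = type_of b].
Proof.
have [N [b ->]] := stype_tp p; apply/mem_set; exists (restrict_model BC N), b.
by apply/funext => phi; exact: eval_fmap.
Qed.

Definition type_restrict (p : stype C n) : stype B n :=
  SigSub (type_restrict_complete p).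

Lemma type_restrict_continuous : continuous type_restrict.
Proof.
move=> p; have FF := @nbhs_pfilter (stype C n) p.
apply: (@stype_cvgP _ _ _ _ _ _ _ (fmap_filter _ _)) => phi.
exact: (@stype_eval_continuous _ _ _ C n (fmap (incl BC) phi) p).
Qed.

Lemma type_restrict_tp (b : 'rV[M]_n) :
  type_restrict (tp (N := self_model C) b) = tp (N := self_model B) b.
Proof. by apply: val_inj; apply/funext => phi; exact: eval_fmap. Qed.

Lemma realizations_restrict (D : set (stype B n)) :
  realizations (self_model C) (type_restrict @^-1` D) =
  realizations (self_model B) D.
Proof.
by apply/seteqP; split=> b; rewrite /realizations /= type_restrict_tp.
Qed.

Lemma tuple_dist_automorphism (g : M -> M) (a b : 'rV[M]_n) : automorphism g ->
  tuple_dist (map_mx g a) (map_mx g b) = tuple_dist a b.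
Proof. by move=> [_ gd _ _]; apply: eq_bigr => i _; rewrite !mxE gd. Qed.

(** The distance from the restriction of [q] to [D] is witnessed by [a] and [b], where [a] realizes
    only that restriction. An automorphism over [B] moves [a] to a realization of [q] and keeps the
    image of [b] in [D]. *)
Lemma definable_restrict (K : Type) (D : set (stype B n)) :
  monster K M -> small K B -> small K C -> definable D ->
  definable (type_restrict @^-1` D).
Proof.
move=> [Knat _ satM homM] sB sC [cD defD]; split.
  by apply: preimage_closed cD => p _; exact: type_restrict_continuous.
move=> e e0; have [U [oU DU Ue]] := defD _ e0.
exists (type_restrict @^-1` U); split.
- by apply: open_comp oU => p _; exact: type_restrict_continuous.
- by move=> p; exact: DU.
- move=> q /Ue /set_dist_ltP[a [b [ta Db ab]]]; apply/set_dist_ltP.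
  have [a' ta'] := stype_realized satM sC q.
  have /same_typeP aa' : tp (N := self_model B) a = tp (N := self_model B) a'.
    by rewrite ta ta' type_restrict_tp.
  have [g [ag gB ga]] := homogeneous_tuple Knat homM sB aa'.
  exists a', (map_mx g b); split; first by rewrite ta'.
    rewrite /= type_restrict_tp (_ : tp _ = tp (N := self_model B) b) //.
    apply/same_typeP => phi.
    rewrite (_ : map_mx g b ord0 = g \o b ord0); first exact: fixes_eval.
    by apply/funext => i; rewrite mxE.
  by rewrite -ga tuple_dist_automorphism.
Qed.

End Restriction.

(** * Strongly minimal sets *)

Section Substitution.
Context (R : realType) (L : signature R) (M : mstructure L) (n : nat).

(** With [y] turned into the second block of variables, it can be moved by automorphisms and
    perturbed in the metric. *)
Lemma params_to_vars (C : set M) (y : 'rV[M]_n)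
    (phi : formula L (C `|` range (y ord0)) n) :
  exists theta : formula L C (n + n), forall x : 'rV[M]_n,
    eval set_val theta (row_mx x y ord0) = eval set_val phi (x ord0).
Proof.
set C' := C `|` _ in phi *.
have hC (c : C') : exists t : term L C (n + n), forall x : 'rV[M]_n,
    teval set_val (row_mx x y ord0) t = set_val c.
  have [Cc|[i _ yi]] := set_valP c.
    by exists (Par L _ (SigSub (mem_set Cc))).
  by exists (Var L C (rshift n i)) => x; rewrite /= row_mxEr.
have [t ht] := choice hC.
exists (fsubst phi (fun i => Var L C (lshift n i)) t) => x.
rewrite eval_fsubst; congr (eval _ phi _); apply/funext => i //=.
by rewrite row_mxEl.
Qed.

Lemma vars_to_params (C : set M) (x : 'rV[M]_n) (theta : formula L C (n + n)) :
  exists phi : formula L (C `|` range (x ord0)) n, forall y : 'rV[M]_n,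
    eval set_val phi (y ord0) = eval set_val theta (row_mx x y ord0).
Proof.
set C' := C `|` _.
have xC i : C' (x ord0 i) by right; exists i.
pose s (k : 'I_(n + n)) : term L C' n := match fintype.split k with
  | inl i => Par L n (SigSub (mem_set (xC i)) : C') | inr i => Var L C' i end.
exists (fsubst theta s (fun c => Par L n (incl (@subsetUl _ C _) c))) => y.
rewrite eval_fsubst; congr (eval _ theta _); apply/funext => k /=.
by rewrite mxE /s; case: splitP.
Qed.

Lemma negE_continuous : continuous (fun v : 'rV[R]_1 => - v ord0 ord0).
Proof. by move=> v; apply: continuousN; exact: coord_continuous. Qed.

Definition fneg (C : Type) k (phi : formula L C k) : formula L C k :=
  Fconn negE_continuous (fun=> phi).

Lemma eval_fneg (C : Type) (c : C -> M) k (phi : formula L C k) e :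
  eval c (fneg phi) e = - eval c phi e.
Proof. by rewrite /= mxE. Qed.

Lemma map_mx_continuous (g : M -> M) : automorphism g ->
  continuous (@map_mx _ _ g 1 n : 'rV[M]_n -> 'rV[M]_n).
Proof.
move=> [_ gd _ _] x U /nbhs_ballP[e /= e0 eU]; apply/nbhs_ballP; exists e => //= y.
move=> /(ball_rowP _ _ e0) xy; apply: eU; apply/ball_rowP => // i.
by rewrite !mxE gd.
Qed.

Lemma map_mx_row0 (g : M -> M) k (x : 'rV[M]_k) : map_mx g x ord0 = g \o x ord0.
Proof. by apply/funext => i; rewrite mxE. Qed.

Lemma map_mx_same_type (g : M -> M) (C : set M) (x : 'rV[M]_n) :
  automorphism g -> fixes g C -> same_type C (map_mx g x) x.
Proof. by move=> ag gC phi; rewrite map_mx_row0 fixes_eval. Qed.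

Lemma fixes_eval_row_mx (g : M -> M) (C : set M) (theta : formula L C (n + n))
    (x y : 'rV[M]_n) : automorphism g -> fixes g C ->
  eval set_val theta (row_mx (map_mx g x) (map_mx g y) ord0) =
  eval set_val theta (row_mx x y ord0).
Proof. by move=> ag gC; rewrite -map_row_mx map_mx_row0 fixes_eval. Qed.

Lemma acl_self (C : set M) (x : 'rV[M]_n) : (forall i, C (x ord0 i)) -> acl C x.
Proof.
move=> xC N; pose y : 'rV[N]_n := \row_i embm N (SigSub (mem_set (xC i))).
apply: (subclosed_compact _ (@compact_set1 _ y)).
  by apply: (@closed_realizations _ _ _ C n N); exact: closed_tp.
move=> z /tp_eqP h; apply/rowP => i; rewrite mxE.
have := h (Fdist (Var L C i) (Par L n (SigSub (mem_set (xC i))))).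
by rewrite /= mdistxx => /mdist_positivity.
Qed.

End Substitution.

(** * The dichotomy and the generic type *)

Section StronglyMinimal.
Context (R : realType) (L : signature R) (K : Type) (M : mstructure L).
Context (hM : monster K M) (A : set M) (hA : small K A) (n : nat).
Context (D : set (stype A n)) (hD : strongly_minimal K D).

Let Knat : small K [set: nat]. Proof. by case: hM. Qed.
Let satM : saturated K M. Proof. by case: hM. Qed.
Let homM : strongly_homogeneous K M. Proof. by case: hM. Qed.

Notation DM := (realizations (self_model A) D).

Let closed_DM : closed DM.
Proof. by apply: closed_realizations; case: hD => -[]. Qed.

Lemma same_type_DM (C : set M) (x y : 'rV[M]_n) : A `<=` C ->
  same_type C x y -> DM x -> DM y.
Proof.
by move=> AC /(same_type_sub AC)/same_typeP; rewrite /realizations /= => ->.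
Qed.

Lemma zeroset_le0 (C : set M) (E : set (stype C n)) (f : stype C n -> R) :
  zeroset E -> continuous f -> zeroset (E `&` [set p | f p <= 0]).
Proof.
(* [f p + |f p|] is twice the positive part of [f p]; the sum of nonnegative terms vanishes iff both
   do. *)
move=> [h ch ->] cf; exists (fun p => `|h p| + (f p + `|f p|)).
  move=> p; have nh := continuous_comp (ch p) (@norm_continuous _ _ _).
  have nf := continuous_comp (cf p) (@norm_continuous _ _ _).
  exact: (continuousD nh (continuousD (cf p) nf)).
apply/seteqP; split=> p /= => [[-> fp]|e].
  by rewrite normr0 add0r (ler0_norm fp) subrr.
have [fp|fp] := leP (f p) 0; last first.
  by have := normr_ge0 (h p); rewrite (gtr0_norm fp) in e; lra.
by split=> //; apply/normr0_eq0; rewrite (ler0_norm fp) in e; lra.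
Qed.

Lemma dichotomy_small (C : set M) (phi : formula L C n) r s :
  small K C -> A `<=` C -> r < s ->
  compact (DM `&` [set x | eval set_val phi (x ord0) <= r]) \/
  compact (DM `&` [set x | s <= eval set_val phi (x ord0)]).
Proof.
move=> sC AC rs; pose E := @type_restrict _ _ _ _ _ AC n @^-1` D.
have EDM : realizations (self_model C) E = DM by exact: realizations_restrict.
have dE : definable E by apply: (definable_restrict AC hM hA sC); case: hD.
have [_ _ minE] := hD.2 _ _ sC dE EDM.
have zE : zeroset E := zeroset_of_definable satM sC dE.
have c1 : continuous (fun p : stype C n => set_val p phi - r).
  move=> p; apply: (continuousB (@stype_eval_continuous _ _ _ C n phi p)).
  exact: cst_continuous.
have c2 : continuous (fun p : stype C n => s - set_val p phi).
  move=> p; apply: (continuousB _ (@stype_eval_continuous _ _ _ C n phi p)).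
  exact: cst_continuous.
have zF := zeroset_le0 zE c1; have zG := zeroset_le0 zE c2.
have FE : E `&` [set p | set_val p phi - r <= 0] `<=` E by move=> ? [].
have GE : E `&` [set p | s - set_val p phi <= 0] `<=` E by move=> ? [].
have := minE _ _ zF zG FE GE.
have -> : (E `&` [set p | set_val p phi - r <= 0]) `&`
    (E `&` [set p | s - set_val p phi <= 0]) = set0.
  by rewrite -subset0 => p [[_ /= h1] [_ /= h2]]; lra.
move=> /(_ erefl) /not_andP[] /contrapT alg; [left|right].
  rewrite (_ : _ `&` _ = realizations (self_model C)
    (E `&` [set p | set_val p phi - r <= 0])); first exact: (alg (self_model C)).
  by rewrite -EDM; apply/seteqP; split=> x /=; rewrite /realizations /= subr_le0.
rewrite (_ : _ `&` _ = realizations (self_model C)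
  (E `&` [set p | s - set_val p phi <= 0])); first exact: (alg (self_model C)).
by rewrite -EDM; apply/seteqP; split=> x /=; rewrite /realizations /= subr_le0.
Qed.

Lemma small_params (C : set M) (phi : formula L C n) : A `<=` C ->
  exists2 S, finite_set S /\ A `|` S `<=` C &
    exists phi' : formula L (A `|` S) n, forall e : 'I_n -> M,
      eval set_val phi' e = eval set_val phi e.
Proof.
move=> AC; have [S [fS SC] hS] := formula_finite_params phi.
exists S; last by apply: hS; exact: subsetUr.
by split=> // x [/AC|/SC].
Qed.

Lemma dichotomy (C : set M) (phi : formula L C n) r s : A `<=` C -> r < s ->
  compact (DM `&` [set x | eval set_val phi (x ord0) <= r]) \/
  compact (DM `&` [set x | s <= eval set_val phi (x ord0)]).
Proof.
move=> AC rs; have [S [fS SC] [phi' hphi']] := small_params phi AC.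
have [h|h] := dichotomy_small phi' (small_setU Knat hA fS) (@subsetUl _ _ _) rs.
  by left; apply: compactI_ext h => x; rewrite /= hphi'.
by right; apply: compactI_ext h => x; rewrite /= hphi'.
Qed.

Lemma DM_not_compact : ~ compact DM.
Proof.
move=> cD; have [_ nalg _] := hD.2 _ _ hA hD.1 erefl.
by apply: nalg; apply: algebraic_of_compact satM hA _ cD; case: hD => -[].
Qed.

Lemma DM_separated : exists e, 0 < e /\ exists d, separated_seq DM e d.
Proof.
apply: contrapT => h; apply: DM_not_compact.
apply: compact_of_not_separated => //; first exact: (@carrier_complete _ _ M).
by move=> e e0 hd; apply: h; exists e.
Qed.

Definition generic (C : set M) (a : 'rV[M]_n) := DM a /\
  forall (phi : formula L C n) r,
    compact (DM `&` [set x | eval set_val phi (x ord0) <= r]) ->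
    r <= eval set_val phi (a ord0).

Lemma generic_upper (C : set M) (a : 'rV[M]_n) (phi : formula L C n) e :
  A `<=` C -> generic C a -> 0 < e ->
  compact (DM `&`
    [set x | eval set_val phi (a ord0) + e <= eval set_val phi (x ord0)]).
Proof.
move=> AC [_ ga] e0; set r := eval _ _ _.
(* The first alternative is excluded: by genericity it would give [r + e / 2 <= r]. *)
have [||//] := @dichotomy C phi (r + e / 2) (r + e) AC; first by lra.
by move=> /ga; rewrite -/r; lra.
Qed.

Lemma not_genericP (C : set M) (a : 'rV[M]_n) : DM a -> ~ generic C a ->
  exists (phi : formula L C n) r, eval set_val phi (a ord0) < r /\
    compact (DM `&` [set x | eval set_val phi (x ord0) <= r]).
Proof.
move=> Da ng; apply: contrapT => h; apply: ng; split=> // phi r cr.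
by rewrite leNgt; apply/negP => ar; apply: h; exists phi, r.
Qed.

Lemma generic_sub (B C : set M) (a : 'rV[M]_n) : B `<=` C ->
  generic C a -> generic B a.
Proof.
move=> BC [Da ga]; split=> // phi r cr.
have E x : eval set_val (fmap (incl BC) phi) x = eval set_val phi x.
  exact: eval_fmap.
rewrite -E; apply: ga; apply: compactI_ext cr => x.
by rewrite /= E.
Qed.

(** The formula witnessing that [a] is not generic lives over a small set, and confines the
    realizations of the type of [a] over that set to a compact part of [D]; there, compactness in
    [M] suffices for algebraicity. *)
Lemma acl_finite_of_not_generic (C : set M) (a : 'rV[M]_n) : A `<=` C ->
  DM a -> ~ generic C a ->
  exists2 S, finite_set S /\ A `|` S `<=` C & acl (A `|` S) a.
Proof.
move=> AC Da /(not_genericP Da)[phi [r [ar cr]]].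
have [S [fS SC] [phi' hphi']] := small_params phi AC.
exists S => //; have sS := small_setU Knat hA fS.
apply: (algebraic_of_compact satM sS (@closed_tp _ _ _ _ _ _)).
apply: (subclosed_compact _ cr).
  apply: (@closed_realizations _ _ _ _ n (self_model (A `|` S))).
  exact: closed_tp.
move=> x /same_typeP tx; split.
  by apply: same_type_DM (@subsetUl _ A S) (same_type_sym tx) Da.
by rewrite /= -hphi' tx hphi' ltW.
Qed.

Lemma acl_of_not_generic (C : set M) (a : 'rV[M]_n) : A `<=` C ->
  DM a -> ~ generic C a -> acl C a.
Proof.
by move=> AC Da /(acl_finite_of_not_generic AC Da)[S [_ SC]]; exact: acl_mono.
Qed.

(** Otherwise the terms lying in [H] would form a separated subsequence of a compact set. *)
Lemma separated_leaves_compact (H : set 'rV[M]_n) e d : 0 < e -> compact H ->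
  separated_seq DM e d -> exists k0, forall k, (k0 <= k)%N -> ~ H (d k).
Proof.
move=> e0 cH [_ sep]; apply: contrapT => h.
have /choice[f hf] k : exists j, (k <= j)%N /\ H (d j).
  apply: contrapT => h2; apply: h; exists k => j kj Hj.
  by apply: h2; exists j.
apply: (compact_not_separated e0 cH).
pose s := fix s i := if i is i'.+1 then f (s i').+1 else f 0%N.
have sS i : (s i < s i.+1)%N by have [] := hf (s i).+1.
exists (d \o s); split=> [[|i]|i j ij] /=; [exact: (hf _).2..|].
apply: sep; elim: j ij => // j IH; rewrite ltnS leq_eqVlt => /orP[/eqP -> //|].
by move=> /IH /ltn_trans; apply.
Qed.

Section Sequence.
Context (e : R) (e0 : 0 < e) (d : nat -> 'rV[M]_n) (sepd : separated_seq DM e d).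

(** Both parts of [D] where [phi] differs from its value at [a] by at least [r], above or below, are
    compact, so the sequence eventually leaves them. *)
Lemma generic_limit (C : set M) (a : 'rV[M]_n) (phi : formula L C n) (r : R) :
  A `<=` C -> generic C a -> 0 < r -> exists k0, forall k, (k0 <= k)%N ->
    `|eval set_val phi (d k ord0) - eval set_val phi (a ord0)| <= r.
Proof.
move=> AC ga r0.
have [k1 h1] := separated_leaves_compact e0
  (generic_upper (phi := phi) AC ga r0) sepd.
have [k2 h2] := separated_leaves_compact e0
  (generic_upper (phi := fneg phi) AC ga r0) sepd.
exists (maxn k1 k2) => k; rewrite geq_max => /andP[/h1 + /h2].
move=> /not_andP[/(_ (sepd.1 k))//|/= /negP n1].
move=> /not_andP[/(_ (sepd.1 k))//|/= /negP n2].
move: n1 n2; rewrite !mxE -!ltNge => n1 n2.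
by rewrite ler_norml; apply/andP; split; lra.
Qed.

Lemma generic_same_type (C : set M) (a b : 'rV[M]_n) : A `<=` C ->
  generic C a -> generic C b -> same_type C a b.
Proof.
move=> AC ga gb phi; apply/eqP; rewrite -subr_eq0 -normr_le0.
apply/ler_addgt0Pl => r r0; rewrite addr0; have r2 : 0 < r / 2 by lra.
have [k1 h1] := generic_limit phi AC ga r2.
have [k2 h2] := generic_limit phi AC gb r2.
have := h1 _ (leq_maxl k1 k2); have := h2 _ (leq_maxr k1 k2).
by rewrite !ler_norml => /andP[u1 u2] /andP[u3 u4]; apply/andP; split; lra.
Qed.

Let shifted k : 'rV[ultrapower M]_n := urow (fun j => d (k + j)%N).

Lemma shifted_separated k l : (k < l)%N -> ~ ball (shifted k) e (shifted l).
Proof.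
move=> kl /(ball_rowP _ _ e0) h.
have : \forall j \near nat_ultra,
    forall i, mdist (d (k + j)%N ord0 i) (d (l + j)%N ord0 i) < e.
  apply: filter_forall => i; have := h i.
  by rewrite !mxE mdist_upi => /udist_lt.
move=> /filter_ex[j hj]; apply: (sepd.2 (k + j)%N (l + j)%N).
  by rewrite ltn_add2r.
by apply/ball_rowP.
Qed.

Lemma generic_not_acl (C : set M) (a : 'rV[M]_n) : A `<=` C ->
  generic C a -> ~ acl C a.
Proof.
move=> AC ga /(_ (ultrapower_over C)) /(compact_not_separated e0); apply.
exists shifted; split=> [k|k l]; last exact: shifted_separated.
apply/tp_eqP => phi; rewrite eval_urow.
have [b hb] := eval_bounded M phi.
apply: (@ulimE _ _ b) => [j|r r0]; first exact: hb.
have [k0 hk] := generic_limit phi AC ga r0.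
apply: filterS (nat_ultra_ge k0) => j k0j; apply: hk.
exact: leq_trans k0j (leq_addl _ _).
Qed.

(** No generic element is given beforehand: the shifts are realized in [M] by saturation with their
    mutual distances, and a formula takes there its ultralimit along the sequence, which eventually
    leaves each compact set. *)
Lemma exists_generics (C : set M) m : small K C -> A `<=` C ->
  exists a : 'I_m -> 'rV[M]_n, (forall i, generic C (a i)) /\
    forall i j, i != j -> ~ ball (a i) e (a j).
Proof.
move=> sC AC.
have [a [ta da]] := realize_family satM (N := ultrapower_over C)
  (fun i : 'I_m => shifted i) sC.
have evE i (phi : formula L C n) : eval set_val phi (a i ord0) =
    ulim (fun j => eval set_val phi (d (i + j)%N ord0)) by rewrite ta eval_urow.
have cvgE (i : 'I_m) (phi : formula L C n) :
    (fun j => eval set_val phi (d (i + j)%N ord0)) @ nat_ultra -->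
    eval set_val phi (a i ord0).
  have [b hb] := eval_bounded M phi; rewrite evE.
  by apply: (@ulim_cvg _ _ b) => j; exact: hb.
exists a; split=> [i|i j ij].
  split=> [|phi r cr].
    have cD : closed D by case: hD => -[].
    apply: (@closed_cvg _ _ nat_ultra _
      (fun j => tp (N := self_model A) (d (i + j)%N)) D cD).
      by apply: (@filterE _ nat_ultra) => j; exact: (sepd.1 (i + j)%N).
    apply: stype_cvgP => phi.
    have := cvgE i (fmap (incl AC) phi).
    by under eq_fun do rewrite eval_fmap; rewrite eval_fmap.
  have [k0 hk] := separated_leaves_compact e0 cr sepd.
  apply: (cvgr_to_ge (cvgE i phi)); apply: filterS (nat_ultra_ge k0) => j k0j.
  have := hk _ (leq_trans k0j (leq_addl i j)).
  by move=> /not_andP[/(_ (sepd.1 _))//|/= /negP]; rewrite -ltNge => /ltW.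
move=> bij.
have bs : ball (shifted i) e (shifted j).
  by apply/ball_rowP => // k; rewrite -da; exact: (proj1 (ball_rowP _ _ e0) bij).
have : (i < j)%N || (j < i)%N by rewrite -neq_ltn.
case/orP => [/shifted_separated nb|/shifted_separated nb].
  exact: nb.
exact: nb (ball_sym bs).
Qed.

End Sequence.

(** * Transitivity and exchange over small sets *)

Lemma acl_not_generic (C : set M) (a : 'rV[M]_n) : A `<=` C -> acl C a ->
  ~ generic C a.
Proof.
move=> AC aC ga; have [e [e0 [d sepd]]] := DM_separated.
exact: (generic_not_acl e0 sepd AC ga).
Qed.

(** An automorphism over [C] sending [y] to [z] carries the fibre of [Q] over [y] continuously onto
    the fibre over [z]; it preserves [D] because [C] contains [A]. *)
Lemma compact_move (C : set M) (Q : 'rV[M]_n -> 'rV[M]_n -> Prop) y z :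
  A `<=` C -> small K C ->
  (forall g x y, automorphism g -> fixes g C ->
    Q (map_mx g x) (map_mx g y) <-> Q x y) ->
  same_type C y z ->
  compact (DM `&` [set x | Q x y]) -> compact (DM `&` [set x | Q x z]).
Proof.
move=> AC sC Qg yz cy; have [g [ag gC <-]] := homogeneous_tuple Knat homM sC yz.
rewrite (_ : _ `&` _ = @map_mx _ _ g 1 n @` (DM `&` [set x | Q x y])).
  apply: continuous_compact cy; apply: continuous_subspaceT.
  exact: map_mx_continuous.
have gD x : DM (map_mx g x) <-> DM x.
  have t : same_type C (map_mx g x) x by exact: map_mx_same_type.
  by split; apply: same_type_DM AC _; [|exact: same_type_sym].
have [[g' _ g'K] _ _ _] := ag.
apply/seteqP; split=> x /= => [[Dx Qx]|[x' [Dx' Qx'] <-]].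
  have xE : map_mx g (map_mx g' x) = x by apply/rowP => i; rewrite !mxE g'K.
  exists (map_mx g' x) => //; split; first by apply/gD; rewrite xE.
  by apply/(Qg g) => //; rewrite xE.
by split; [apply/gD|apply/(Qg g)].
Qed.

(* The conjugates of [y] over [C] form a compact set, which a finite net
   approximates; so the conjugates of [a] lie in finitely many translates of a
   compact set. *)
Lemma acl_trans (C : set M) (a y : 'rV[M]_n) : A `<=` C -> small K C ->
  DM a -> acl C y -> acl (C `|` range (y ord0)) a -> acl C a.
Proof.
move=> AC sC Da aCy.
have ACy : A `<=` C `|` range (y ord0) by move=> x /AC; left.
move=> /(acl_not_generic ACy) /(not_genericP Da)[phi [r [ar cr]]].
have [theta thetaE] := params_to_vars phi.
pose Q (x z : 'rV[M]_n) := eval set_val theta (row_mx x z ord0) <= r.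
have cW z : same_type C y z -> compact (DM `&` [set x | Q x z]).
  move=> yz; apply: (@compact_move C Q y z AC sC _ yz) => [g x x' ag gC|].
    by rewrite /Q fixes_eval_row_mx.
  by apply: compactI_ext cr => x; rewrite /Q /= thetaE.
(* This slack pays for replacing a conjugate of [y] by a nearby point of the finite net. *)
have e0 : 0 < r - eval set_val phi (a ord0) by rewrite subr_gt0.
have [d d0 hd] := eval_unif_continuous (fun c : C => set_val c) theta e0.
have [s [sY hs]] := finite_net (compact_not_separated d0 (aCy (self_model C))).
have {}sY z : z \in s -> same_type C y z.
  by move=> /sY/same_typeP/same_type_sym.
have cU : compact (\bigcup_(z in [set` s]) (DM `&` [set x | Q x z])).
  rewrite bigcup_seq big_seq; apply: bigsetU_compact => z /sY; exact: cW.
apply: (algebraic_of_compact satM sC (@closed_tp _ _ _ _ _ _)).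
apply: (subclosed_compact _ cU).
  by apply: (@closed_realizations _ _ _ _ n (self_model C)); exact: closed_tp.
move=> x /same_typeP/same_type_sym tx.
have [g [ag gC gx]] := homogeneous_tuple Knat homM sC tx.
have [|z zs bz] := hs (map_mx g y).
  by apply/same_typeP; exact: map_mx_same_type.
exists z => //; split; first exact: same_type_DM AC tx Da.
have thE : eval set_val theta (row_mx x (map_mx g y) ord0) =
    eval set_val phi (a ord0) by rewrite -gx fixes_eval_row_mx// thetaE.
have := hd (row_mx x z ord0) (row_mx x (map_mx g y) ord0); rewrite thE /Q /=.
have dd k : mdist (row_mx x z ord0 k) (row_mx x (map_mx g y) ord0 k) < d.
  rewrite !mxE; case: fintype.splitP => j _; first by rewrite mdistxx.
  exact: (proj1 (ball_rowP _ _ d0) bz).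
by move=> /(_ dd); rewrite ler_norml => /andP[_]; lra.
Qed.

(* If [b] were generic over [C] and [a], the generic elements [a' j] over [C] would
   all satisfy [theta (a' j) b'] for a common generic [b'], i.e. too many separated
   elements would lie in a conjugate of the compact set [theta _ b]. *)
Lemma acl_exchange (C : set M) (a b : 'rV[M]_n) : A `<=` C -> small K C ->
  DM a -> DM b -> acl (C `|` range (b ord0)) a -> ~ acl C a ->
  acl (C `|` range (a ord0)) b.
Proof.
move=> AC sC Da Db aCb naC.
have ACx x : A `<=` C `|` range (x : 'I_n -> M) by move=> ? /AC; left.
apply: contrapT => nb.
have ga : generic C a.
  by apply: contrapT => /(acl_of_not_generic AC Da).
have gb : generic (C `|` range (a ord0)) b.
  by apply: contrapT => /(acl_of_not_generic (ACx _) Db).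
have gbC : generic C b by apply: generic_sub gb; exact: subsetUl.
have [phi [r [ar cr]]] := not_genericP Da (acl_not_generic (ACx _) aCb).
have [theta thetaE] := params_to_vars phi.
pose th (x z : 'rV[M]_n) := eval set_val theta (row_mx x z ord0).
have thg g x z : automorphism g -> fixes g C ->
    th (map_mx g x) (map_mx g z) = th x z by exact: fixes_eval_row_mx.
have {}cr : compact (DM `&` [set x | th x b <= r]).
  by apply: compactI_ext cr => x; rewrite /th /= thetaE.
have {}ar : th a b < r by rewrite /th thetaE.
have [e [e0 [d sepd]]] := DM_separated.
have [m hm] := compact_pigeonhole e0 cr.
have [a' [ga' sepa']] := exists_generics e0 sepd m sC AC.
(* Midpoint: above [th a b], so that genericity of [b] makes the part [s <= th a y] compact, and
   below [r], so that [th x b <= s] stays inside the compact set counted by [m]. *)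
pose s := (th a b + r) / 2.
have cs x : same_type C a x -> compact (DM `&` [set y | s <= th x y]).
  move=> ax; apply: (@compact_move C (fun y x => s <= th x y) a x AC sC _ ax).
    by move=> g ? ? ag gC; rewrite thg.
  have [psi psiE] := vars_to_params a theta.
  have h0 : 0 < (r - th a b) / 2 by lra.
  apply: compactI_ext (generic_upper (phi := psi) (ACx _) gb h0) => y.
  by rewrite /= !psiE -/(th a b) -/(th a y) /s; split; lra.
(* All the [a' j] become parameters, so that one element is generic over each of them
   simultaneously. *)
pose C' := C `|` \bigcup_j range (a' j ord0).
have CC' : C `<=` C' by exact: subsetUl.
have sC' : small K C'.
  apply: small_setU => //; apply: bigcup_finite => // j _.
  exact/finite_image/finite_finset.
have [b' [gb' _]] := exists_generics e0 sepd 1 sC' (subset_trans AC CC').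
have {}gb' := gb' ord0; set b0 := b' ord0 in gb'.
have hb0 j : th (a' j) b0 <= s.
  have CjC' : C `|` range (a' j ord0) `<=` C'.
    by move=> x [|xj]; [left|right; exists j].
  have [psi psiE] := vars_to_params (a' j) theta.
  have [_ /(_ (fneg psi) (- s))] := generic_sub CjC' gb'.
  rewrite eval_fneg psiE lerN2; apply.
  have aj : same_type C a (a' j) by exact: (generic_same_type e0 sepd AC).
  by apply: compactI_ext (cs _ aj) => y; rewrite /= mxE psiE lerN2.
(* Generic elements over [C] are conjugate; moving [b0] to [b] brings the [m] separated elements
   into the fibre over [b] itself. *)
have tb : same_type C b0 b.
  by apply: (generic_same_type e0 sepd AC) => //; exact: generic_sub gb'.
have [g [ag gC gb0]] := homogeneous_tuple Knat homM sC tb.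
have [j|i [j [ij bij]]] := hm (fun j => map_mx g (a' j)).
  split.
    have [Dj _] := ga' j; apply: same_type_DM AC _ Dj.
    by apply: same_type_sym; exact: map_mx_same_type.
  by rewrite /= -gb0 thg//; apply: le_trans (hb0 j) _; rewrite /s; lra.
apply: (sepa' _ _ ij); apply/ball_rowP => // k.
have [_ gd _ _] := ag.
by have := proj1 (ball_rowP _ _ e0) bij k; rewrite !mxE gd.
Qed.

(** * The closure operator on arbitrary subsets of [D] *)

Lemma finite_coordinates (X : set 'rV[M]_n) :
  finite_set X -> finite_set (coordinates X).
Proof.
move=> fX; apply: (sub_finite_set (B := \bigcup_(x in X) range (x ord0))).
  by move=> t [x Xx [i ->]]; exists x => //; exists i.
by apply: bigcup_finite => // x _; exact/finite_image/finite_finset.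
Qed.

Lemma coordinates_sub (X Y : set 'rV[M]_n) :
  X `<=` Y -> coordinates X `|` A `<=` coordinates Y `|` A.
Proof.
move=> XY t [[x Xx xt]|At]; last by right.
by left; exists x => //; exact: XY.
Qed.

Lemma coordinatesU1 (X : set 'rV[M]_n) y :
  coordinates (X `|` [set y]) `|` A `<=` (coordinates X `|` A) `|` range (y ord0).
Proof.
move=> t [[x [Xx|->] [i ->]]|At].
- by left; left; exists x => //; exists i.
- by right; exists i.
- by left; right.
Qed.

Lemma acl_on_mono (X Y : set 'rV[M]_n) : X `<=` Y -> acl_on D X `<=` acl_on D Y.
Proof.
by move=> XY a [aX Da]; split=> //; apply: acl_mono aX; exact: coordinates_sub.
Qed.

Lemma acl_on_extensive (X : set 'rV[M]_n) : X `<=` DM -> X `<=` acl_on D X.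
Proof.
move=> XD x Xx; split; last exact: XD.
by apply: acl_self => i; left; exists x => //; exists i.
Qed.

Lemma small_coordinates (X : set 'rV[M]_n) :
  finite_set X -> small K (coordinates X `|` A).
Proof. by move=> /finite_coordinates fX; rewrite setUC; exact: small_setU. Qed.

Lemma acl_on_finite (X : set 'rV[M]_n) a : acl_on D X a ->
  exists X0, [/\ finite_set X0, X0 `<=` X & acl_on D X0 a].
Proof.
move=> [aX Da]; have AC : A `<=` coordinates X `|` A by exact: subsetUr.
have [S [fS SC] aS] :=
  acl_finite_of_not_generic AC Da (acl_not_generic AC aX).
(* Each parameter that is a coordinate of [X] is traced back to a row of [X]; for the other values
   of [t], [a] is a dummy. *)
have /choice[f hf] t : exists x : 'rV[M]_n,
    coordinates X t -> X x /\ exists i, t = x ord0 i.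
  have [[x Xx xt]|nt] := pselect (coordinates X t); first by exists x.
  by exists a => /nt.
exists (f @` (S `&` coordinates X)); split.
- exact/finite_image/finite_setIl.
- by move=> _ [t [_ /hf[Xt _]] <-].
- split=> //; apply: acl_mono aS => t [At|St]; first by right.
  have [Xt|At] := SC t (or_intror St); last by right.
  by left; exists (f t); [exists t|have [] := hf t Xt].
Qed.

(** Transitivity removes the algebraic tuples one at a time; [X] is finite so that the parameter
    sets stay small. *)
Lemma acl_on_drop (X : set 'rV[M]_n) (s : seq 'rV[M]_n) a : finite_set X ->
  (forall y, y \in s -> acl_on D X y) -> acl_on D (X `|` [set` s]) a ->
  acl_on D X a.
Proof.
move=> fX; elim: s => [|y s IH] hs; first by rewrite set_nil setU0.
move=> aXys; apply: IH => [z zs|]; first by apply: hs; rewrite inE zs orbT.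
have [aX Da] := aXys; split=> //.
have AC : A `<=` coordinates (X `|` [set` s]) `|` A by exact: subsetUr.
apply: (@acl_trans _ a y AC) => //.
- apply: small_coordinates; by rewrite finite_setU; split.
- have [yX _] := hs y (mem_head _ _); apply: acl_mono yX.
  exact/coordinates_sub/subsetUl.
- apply: acl_mono aX; apply: subset_trans (@coordinatesU1 _ y).
  apply: coordinates_sub => z [Xz|]; first by left; left.
  by rewrite /= inE => /orP[/eqP ->|zs]; [right|left; right].
Qed.

(** Finite character is used twice, for [a] over the closure and for each of the finitely many
    tuples it needs, which leaves a finite [X0] over which transitivity is available. *)
Lemma acl_on_idempotent (X : set 'rV[M]_n) : X `<=` DM ->
  acl_on D (acl_on D X) = acl_on D X.
Proof.
move=> XD; apply/seteqP; split; last by apply: acl_on_extensive => x [].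
move=> a /acl_on_finite[Y [fY YX aY]].
have /choice[F hF] y : exists X0, acl_on D X y ->
    [/\ finite_set X0, X0 `<=` X & acl_on D X0 y].
  have [yX|nyX] := pselect (acl_on D X y); last by exists set0 => /nyX.
  by have [X0 ?] := acl_on_finite yX; exists X0.
pose X0 := \bigcup_(y in Y) F y.
have X0X : X0 `<=` X by move=> x [y Yy]; have [_ + _] := hF y (YX y Yy); exact.
apply: (acl_on_mono X0X); have [s sY] : exists s : seq 'rV[M]_n, Y = [set` s].
  exact/finite_seqP.
apply: (@acl_on_drop _ s).
- by apply: bigcup_finite => // y Yy; have [] := hF y (YX y Yy).
- move=> y ys; have Yy : Y y by rewrite sY.
  by have [_ _] := hF y (YX y Yy); apply: acl_on_mono => x Fx; exists y.
- by rewrite -sY; apply: acl_on_mono aY; exact: subsetUr.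
Qed.

(** Finite character replaces [X] by the finite [X0]; that [a] is not algebraic is inherited by the
    smaller set. *)
Lemma acl_on_exchange (X : set 'rV[M]_n) a b : DM a -> DM b ->
  acl_on D (X `|` [set b]) a -> ~ acl_on D X a -> acl_on D (X `|` [set a]) b.
Proof.
move=> Da Db /acl_on_finite[Y [fY YX aY]] naX.
pose X0 := Y `&` X.
have fX0 : finite_set X0 by exact: finite_setIl.
have YX0 : Y `<=` X0 `|` [set b].
  by move=> y Yy; have [Xy|] := YX y Yy; [left|right].
have AC : A `<=` coordinates X0 `|` A by exact: subsetUr.
have [aX0b _] := acl_on_mono YX0 aY.
split=> //; apply: (@acl_mono _ _ _ ((coordinates X0 `|` A) `|` range (a ord0))).
  move=> t [[[x X0x xt]|At]|[i _ <-]].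
  - by left; exists x => //; left; case: X0x.
  - by right.
  - by left; exists a; [right|exists i].
apply: (acl_exchange AC (small_coordinates fX0) Da Db).
  by apply: acl_mono aX0b; exact: coordinatesU1.
move=> aX0; apply: naX; apply: (acl_on_mono (@subIsetr _ Y X)).
exact: (conj aX0 Da).
Qed.

End StronglyMinimal.

Theorem proposition5p5 (R : realType) (L : signature R) (K : Type)
    (M : mstructure L) (hM : monster K M) (A : set M) (hA : small K A)
    (n : nat) (D : set (stype A n)) (hD : strongly_minimal K D) :
  pregeometry (realizations (self_model A) D) (acl_on D) /\
  finite_character (realizations (self_model A) D) (acl_on D).
Proof.
split; last by move=> X a _; exact: (acl_on_finite hM hA hD).
split.
- by move=> X _ a [].
- exact: acl_on_extensive.
- by move=> X Y _; exact: acl_on_mono.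
- exact: (acl_on_idempotent hM hA hD).
- by move=> X a b _; exact: (acl_on_exchange hM hA hD).
Qed.
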